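(* Let $\tau$ be the Golomb topology on $\mathbb{N}=\{1,2,3,\dots\}$. The set $\Pi$ of prime numbers is a dense subset of $(\mathbb{N},\tau)$ and is metrizable in the subspace topology. Moreover, $\Pi$ with the subspace topology is homeomorphic to the space $\mathbb{Q}$ of rational numbers (with its usual topology).
   Context: $\mathbb{N}$ is the set of positive integers and $\mathbb{N}_0=\{0\}\cup\mathbb{N}$. The Golomb topology $\tau$ on $\mathbb{N}$ is the topology generated by the base consisting of all arithmetic progressions $a+b\mathbb{N}_0=\{a+bn:n\in\mathbb{N}_0\}$ with $a,b\in\mathbb{N}$ coprime. *)

(* Defs.v *)
From HB Require Import structures.
From mathcomp Require Import all_boot all_order all_algebra.
From mathcomp Require Import all_classical all_reals all_analysis.

Set Implicit Arguments.
Unset Strict Implicit.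
Unset Printing Implicit Defensive.

Import Order.TTheory GRing.Theory Num.Theory.

Local Open Scope classical_set_scope.
Local Open Scope ring_scope.

(* The positive integers; a type of its own, so that it carries the Golomb
   topology and not another one. *)
Definition golomb : Type := {n : nat | (0 < n)%N}.

HB.instance Definition _ := SubChoice.copy golomb {n : nat | (0 < n)%N}.

Definition progression (ab : nat * nat) : set golomb :=
  [set x | exists n : nat, val x = (ab.1 + ab.2 * n)%N].

Definition golomb_index : set (nat * nat) :=
  [set ab | [/\ (0 < ab.1)%N, (0 < ab.2)%N & coprime ab.1 ab.2]].

Lemma progression_cover :
  \bigcup_(ab in golomb_index) progression ab = [set: golomb].
Proof.
apply/seteqP; split=> // x _; exists (val x, 1%N); last by exists 0%N; rewrite addn0.
by split; [exact: valP | | exact: coprimen1].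
Qed.

Lemma progression_join i j t : golomb_index i -> golomb_index j ->
    progression i t -> progression j t ->
  exists k, [/\ golomb_index k, progression k t &
                progression k `<=` progression i `&` progression j].
Proof.
case: i j => [a b] [c d] [/= a0 b0 ab] [/= c0 d0 cd] [n /= tn] [m /= tm].
exists (val t, (b * d)%N); split=> /=.
- split=> /=; [exact: valP | by rewrite muln_gt0 b0 |].
  rewrite coprimeMr; apply/andP; split.
  + by rewrite tn /coprime gcdnC mulnC addnC gcdnMDl gcdnC.
  + by rewrite tm /coprime gcdnC mulnC addnC gcdnMDl gcdnC.
- by exists 0%N; rewrite /= muln0 addn0.
- move=> x [k /= xk]; split.
  + by exists (n + d * k)%N; rewrite /= xk tn -addnA mulnDr mulnA.
  + by exists (m + b * k)%N; rewrite /= xk tm -addnA mulnDr mulnCA mulnA.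
Qed.

HB.instance Definition _ := isBaseTopological.Build golomb
  progression_cover progression_join.

Definition primes_set : set golomb := [set x | prime (val x)].

Definition is_metric (R : realType) (T : Type) (d : T -> T -> R) : Prop :=
  [/\ forall x y, 0 <= d x y,
      forall x y, d x y = 0 <-> x = y,
      forall x y, d x y = d y x &
      forall x y z, d x z <= d x y + d y z].

Definition metrizable (R : realType) (T : topologicalType) : Prop :=
  exists2 d : T -> T -> R, is_metric d &
    forall A : set T,
      open A <->
      forall x, A x -> exists2 e : R, 0 < e & [set y | d x y < e] `<=` A.

Definition homeomorphic (T U : topologicalType) : Prop :=
  exists (f : T -> U) (g : U -> T),
    [/\ cancel f g, cancel g f, continuous f & continuous g].

(* Main.v *)
From HB Require Import structures.
From mathcomp Require Import all_boot all_order all_algebra.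
From mathcomp Require Import all_fingroup all_solvable all_field all_character.
From mathcomp Require Import complex ring lra zify.
From mathcomp Require Import all_classical all_reals all_analysis.
Require Import Defs.

(* Density of the primes is Dirichlet's theorem.  It is proved by estimating the
   finite sums of chi(n) Lambda(n) / n up to N for the characters chi modulo m.
   Such a sum is bounded when L(1, chi) <> 0, and is -ln N + O(1) when
   L(1, chi) = 0, while the trivial character gives ln N + O(1).  Since the total
   over all characters is nonnegative, at most one L(1, chi) vanishes; conjugating,
   such a chi is real, and Monsky's argument excludes real chi.

   For the topology, if b is coprime to the prime p and q < r are primes larger
   than p and b with r = 1 modulo q, then the progression p + b q r N is clopen
   among the primes, although progressions are not closed there in general.  So
   the primes form a countable space without isolated points with a countable
   clopen base at each point.  In any such space, repeated splitting of a clopen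
   set into a small neighbourhood of its first point and the remainder codes the
   points by the finitely supported bit sequences, with cylinders as neighbourhoods.
   The rationals are coded likewise, which gives the homeomorphism; the metric of
   the primes is pulled back along it. *)

Set Implicit Arguments.
Unset Strict Implicit.
Unset Printing Implicit Defensive.

Import Order.TTheory GRing.Theory Num.Theory.

Local Open Scope ring_scope.

(** * Chebyshev and Mertens estimates *)

Lemma sum_multiples (V : nmodType) (d N : nat) (G : nat -> V) : (0 < d)%N ->
  \sum_(1 <= n < N.+1 | (d %| n)%N) G n =
  \sum_(1 <= e < (N %/ d).+1) G (d * e)%N.
Proof.
move=> d0; elim: N => [|N IHN]; first by rewrite div0n !big_nil.
rewrite big_mkcond big_nat_recr //= -big_mkcond /= IHN divnS //.
case: ifPn => [dN|_]; last by rewrite addr0.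
rewrite add1n [RHS]big_nat_recr //=; congr (_ + G _).
by move: (divnS N d0); rewrite dN add1n => <-; rewrite mulnC divnK.
Qed.

(** Turns a summed Dirichlet convolution into a sum over pairs with [d * e <= N]; the summed
    convolution identities below go through it. *)
Lemma sum_divisors (V : nmodType) (N : nat) (F : nat -> nat -> V) :
  \sum_(1 <= n < N.+1) \sum_(1 <= d < N.+1 | (d %| n)%N) F d (n %/ d)%N =
  \sum_(1 <= d < N.+1) \sum_(1 <= e < (N %/ d).+1) F d e.
Proof.
rewrite (exchange_big_dep xpredT) //= big_nat_cond [RHS]big_nat_cond.
apply: eq_bigr => d /andP[/andP[d0 _] _].
rewrite (@sum_multiples _ d N (fun n => F d (n %/ d)%N)) //.
by apply: eq_bigr => e _; rewrite mulKn.
Qed.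

Section Mangoldt.
Variable R : realType.
Implicit Types (n N p k d : nat).

Lemma lnM_nat a b : (0 < a)%N -> (0 < b)%N ->
  ln (a * b)%:R = ln a%:R + ln b%:R :> R.
Proof. by move=> a0 b0; rewrite natrM lnM // posrE ltr0n. Qed.

Lemma ln_nat_ge0 n : 0 <= ln n%:R :> R.
Proof.
case: n => [|n]; first by rewrite ln0.
by apply: ln_ge0; rewrite ler1n.
Qed.

Lemma ln_nat_le a b : (0 < a)%N -> (a <= b)%N -> ln a%:R <= ln b%:R :> R.
Proof.
move=> a0 ab; rewrite ler_ln ?ler_nat // posrE ltr0n //.
exact: leq_trans ab.
Qed.

Lemma lnS_le n : (0 < n)%N -> ln n.+1%:R <= ln n%:R + n%:R^-1 :> R.
Proof.
move=> n0; have n0' : 0 < n%:R :> R by rewrite ltr0n.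
have -> : n.+1%:R = n%:R * (1 + n%:R^-1) :> R.
  by rewrite mulrDr mulr1 mulfV ?gt_eqF // natr1.
have h : 0 < 1 + n%:R^-1 :> R by rewrite addr_gt0 // invr_gt0.
rewrite lnM ?posrE // lerD2l le_ln1Dx // (lt_trans (ltrN10 _)) // invr_gt0 //.
Qed.

(** A weak Stirling bound; the induction step costs only [ln (N + 1) <= ln N + 1 / N]. *)
Lemma sum_ln_ge N :
  N%:R * ln N%:R - N%:R <= \sum_(1 <= n < N.+1) ln n%:R :> R.
Proof.
elim: N => [|N IHN]; first by rewrite big_nil mul0r subr0.
rewrite big_nat_recr //=; have [->|N0] := posnP N.
  by rewrite ln1 big_nil mulr0; lra.
have N0' : 0 < N%:R :> R by rewrite ltr0n.
have : N%:R * ln N.+1%:R <= N%:R * (ln N%:R + N%:R^-1) :> R.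
  by rewrite ler_pM2l // lnS_le.
rewrite mulrDr mulfV ?gt_eqF // -[N.+1%:R]natr1 => h; lra.
Qed.

Lemma sum_ln_le N : \sum_(1 <= n < N.+1) ln n%:R <= N%:R * ln N%:R :> R.
Proof.
have -> : N%:R * ln N%:R = \sum_(1 <= n < N.+1) ln N%:R :> R.
  by rewrite sumr_const_nat subn1 mulr_natl.
by apply: ler_sum_nat => n /andP[n0 nN]; exact: ln_nat_le.
Qed.

(** The von Mangoldt function, written over all pairs with [p ^ k = n] so that weighted sums of it
    unfold into sums over prime powers without case analysis. *)
Definition mangoldt n : R :=
  \sum_(1 <= p < n.+1 | prime p) \sum_(1 <= k < n.+1 | (p ^ k)%N == n) ln p%:R.

Lemma mangoldt_widen N n : (n <= N)%N -> mangoldt n =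
  \sum_(1 <= p < N.+1 | prime p) \sum_(1 <= k < N.+1 | (p ^ k)%N == n) ln p%:R.
Proof.
move=> nN; rewrite /mangoldt (big_nat_widen _ _ N.+1) //.
rewrite [LHS]big_mkcond [RHS]big_mkcond /=.
apply: eq_bigr => p _; case: ifPn => [/andP[pp pn]|].
  rewrite pp (big_nat_widen _ _ N.+1) //; apply: eq_bigl => k.
  apply: andb_idr => /eqP <-; rewrite ltnS ltnW //.
  exact: ltn_expl (prime_gt1 pp).
case: (boolP (prime p)) => //= pp pn; rewrite big_nat_cond big_pred0 // => k.
apply/negbTE/negP => /andP[/andP[k0 _] /eqP pk]; case/negP: pn.
by rewrite -pk ltnS -{1}[p]expn1 leq_exp2l // prime_gt1.
Qed.

Lemma mangoldt_ge0 n : 0 <= mangoldt n.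
Proof. by do 2!apply: sumr_ge0 => *; exact: ln_nat_ge0. Qed.

Lemma sum_mangoldt N (G : nat -> R) :
  \sum_(1 <= n < N.+1) mangoldt n * G n =
  \sum_(1 <= p < N.+1 | prime p) \sum_(1 <= k < N.+1 | (p ^ k <= N)%N)
    ln p%:R * G (p ^ k)%N.
Proof.
rewrite big_nat_cond (eq_bigr (fun n => \sum_(1 <= p < N.+1 | prime p)
   \sum_(1 <= k < N.+1 | (p ^ k)%N == n) ln p%:R * G n)); last first.
  move=> n /andP[/andP[_ nN] _]; rewrite (@mangoldt_widen N n) // mulr_suml.
  by apply: eq_bigr => p _; rewrite mulr_suml.
rewrite -big_nat_cond exchange_big /=; apply: eq_bigr => p pp.
rewrite (exchange_big_dep xpredT) //= [RHS]big_mkcond /=.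
apply: eq_bigr => k _; have pk0 : (0 < p ^ k)%N by rewrite expn_gt0 prime_gt0.
under eq_bigl do rewrite eq_sym.
by rewrite big_nat1_eq pk0 ltnS.
Qed.

Lemma logn_sum N n p : (0 < n <= N)%N -> prime p ->
  logn p n = \sum_(1 <= k < N.+1 | (p ^ k %| n)%N) 1%N.
Proof.
move=> /andP[n0 nN] pp; under eq_bigl do rewrite pfactor_dvdn //.
have lN : (logn p n <= N)%N.
  by rewrite (leq_trans _ nN) // ltnW // ltn_logl.
under eq_bigl do rewrite -ltnS.
rewrite -(big_nat_widen 1 (logn p n).+1 N.+1 xpredT) //.
by rewrite sum_nat_const_nat muln1 subn1.
Qed.

Lemma ln_logn N n : (0 < n <= N)%N ->
  ln n%:R = \sum_(1 <= p < N.+1 | prime p) (logn p n)%:R * ln p%:R :> R.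
Proof.
move=> /andP[n0 nN]; rewrite -{1}(partnT n0) (@widen_partn N) //.
rewrite (big_cat_nat _ (n := 1)) //= big_nat1 lognE /= mul1n.
have lnprod (s : seq nat) : all (fun p => 0 < p)%N s ->
    ln (\prod_(p <- s) p ^ logn p n)%:R
    = \sum_(p <- s) (logn p n)%:R * ln p%:R :> R.
  elim: s => [|p s IHs] /=; first by rewrite !big_nil ln1.
  move=> /andP[p0 s0]; rewrite !big_cons lnM_nat ?expn_gt0 ?p0 //; last first.
    by rewrite prodn_cond_gt0.
  rewrite IHs // natrX lnXn ?ltr0n // mulr_natl //.
rewrite lnprod; last by apply/allP => p; rewrite mem_index_iota => /andP[].
rewrite [RHS]big_mkcond; apply: eq_bigr => p _.
by case: ifPn => // /negbTE pp; rewrite lognE pp mul0r.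
Qed.

(** Both sides count [ln p] once for each [k >= 1] such that [p ^ k] divides [n]. *)
Lemma ln_mangoldt N n : (0 < n <= N)%N ->
  ln n%:R = \sum_(1 <= d < N.+1 | (d %| n)%N) mangoldt d.
Proof.
move=> n0N; have /andP[n0 nN] := n0N.
rewrite (ln_logn n0N).
have -> : \sum_(1 <= d < N.+1 | (d %| n)%N) mangoldt d =
    \sum_(1 <= d < N.+1) mangoldt d * (d %| n)%N%:R.
  rewrite big_mkcond; apply: eq_bigr => d _.
  by case: (d %| n)%N; rewrite ?mulr1 ?mulr0.
rewrite (sum_mangoldt N (fun d => (d %| n)%N%:R)) [LHS]big_mkcond [RHS]big_mkcond.
apply: eq_bigr => p _; case: ifPn => // pp.
rewrite (logn_sum n0N pp) natr_sum mulr_suml big_mkcond [RHS]big_mkcond.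
apply: eq_bigr => k _; case: (boolP (p ^ k %| n)%N) => [pkn|_] /=.
  by rewrite mul1r mulr1 (leq_trans (dvdn_leq n0 pkn) nN).
by rewrite mulr0 if_same.
Qed.

Lemma sum_ln_mangoldt N : \sum_(1 <= n < N.+1) ln n%:R =
  \sum_(1 <= d < N.+1) mangoldt d * (N %/ d)%:R.
Proof.
rewrite big_nat_cond (eq_bigr (fun n =>
   \sum_(1 <= d < N.+1 | (d %| n)%N) mangoldt d)); last first.
  by move=> n /andP[/andP[n0 nN] _]; apply: ln_mangoldt; rewrite n0.
rewrite -big_nat_cond (sum_divisors N (fun d _ => mangoldt d)).
by apply: eq_bigr => d _; rewrite sumr_const_nat subn1 mulr_natr.
Qed.

Definition psi N := \sum_(1 <= d < N.+1) mangoldt d.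

Lemma psi_le N N' : (N <= N')%N -> psi N <= psi N'.
Proof.
move=> NN'; rewrite /psi [leRHS](big_cat_nat _ (n := N.+1)) //= lerDl.
by apply: sumr_ge0 => *; exact: mangoldt_ge0.
Qed.

Lemma ln_fact N : \sum_(1 <= n < N.+1) ln n%:R = ln N`!%:R :> R.
Proof.
elim: N => [|N IHN]; first by rewrite big_nil ln1.
by rewrite big_nat_recr //= IHN factS lnM_nat ?fact_gt0 // addrC.
Qed.

(* [ln 'C(2N, N)] weighs [mangoldt d] by [2N %/ d - 2 (N %/ d)], which is 1 for
   [N < d <= 2N]. *)
Lemma psi_double N : psi N.*2 - psi N <= N.*2%:R * ln 2%:R.
Proof.
have binN : ln N.*2`!%:R - (ln N`!%:R + ln N`!%:R) <= N.*2%:R * ln 2%:R :> R.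
  have h : (N <= N.*2)%N by rewrite -addnn leq_addr.
  rewrite -(bin_fact h) -addnn addnK addnn lnM_nat ?bin_gt0 ?muln_gt0 ?fact_gt0 //.
  rewrite lnM_nat ?fact_gt0 // addrK mulr_natl -lnXn ?ltr0n // -natrX.
  apply: ln_nat_le; first by rewrite bin_gt0.
  rewrite -[2%N]/(1 + 1)%N expnDn (bigD1 (inord N)) //= inordK ?ltnS //.
  by rewrite !exp1n !muln1 leq_addr.
apply: le_trans binN; rewrite -!ln_fact !sum_ln_mangoldt.
have widen (F : nat -> R) : (forall d, (N < d)%N -> F d = 0) ->
    \sum_(1 <= d < N.+1) F d = \sum_(1 <= d < N.*2.+1) F d.
  move=> F0; rewrite [RHS](big_cat_nat _ (n := N.+1)) //=; last first.
    by rewrite ltnS -addnn leq_addr.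
  rewrite [X in _ + X]big1_seq ?addr0 // => d /andP[_].
  by rewrite mem_index_iota => /andP[/F0].
rewrite (widen (fun d => mangoldt d * _)); last first.
  by move=> d Nd; rewrite divn_small // mulr0.
rewrite -big_split /= -sumrB /psi [X in X - _](big_cat_nat _ (n := N.+1)) //=; last first.
  by rewrite ltnS -addnn leq_addr.
rewrite addrAC subrr add0r.
rewrite [leRHS](big_cat_nat _ (n := N.+1)) //=; last first.
  by rewrite ltnS -addnn leq_addr.
rewrite -[leLHS]add0r; apply: lerD.
  apply: sumr_ge0 => d _; rewrite subr_ge0 -mulrDr ler_wpM2l ?mangoldt_ge0 //.
  rewrite -natrD ler_nat addnn -!muln2.
  have [->|d0] := posnP d; first by rewrite !divn0.
  by rewrite leq_divRL // mulnAC leq_mul2r leq_trunc_div orbT.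
apply: ler_sum_nat => d /andP[Nd dN]; rewrite (@divn_small N d) // mulr0 addr0 subr0.
by rewrite -[leLHS]mulr1 ler_wpM2l ?mangoldt_ge0 // ler1n divn_gt0 // (leq_trans _ Nd).
Qed.

Lemma ln2_le1 : ln 2%:R <= 1 :> R.
Proof. by have := @lnS_le 1 isT; rewrite ln1 invr1 add0r. Qed.

(** Strong induction by halving, from [psi (2 n) <= psi n + 2 n]. An odd argument [2 h + 3] is
    rounded up to [2 (h + 2)], and the constant 4 is just enough for [6 (h + 2) <= 4 (2 h + 3)]. *)
Lemma psi_le_linear N : psi N <= 4 * N%:R.
Proof.
have step n : psi n.*2 <= psi n + n.*2%:R.
  rewrite -lerBlDl (le_trans (psi_double n)) // ler_piMr //; exact: ln2_le1.
elim/ltn_ind: N => -[|[|N]] IHN.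
- by rewrite /psi big_nil mulr0.
- rewrite /psi big_nat1 /mangoldt big_nat_cond big_pred0 ?mulr1 //.
  by case=> [|[|p]].
have := odd_double_half N; set h := N./2; case: (odd N) => Nh.
  have H1 : psi N.+2 <= psi h.+2.*2 by apply: psi_le; lia.
  have H2 : psi h.+2 <= 4 * h.+2%:R by apply: IHN; lia.
  have := step h.+2; have -> : N.+2%:R = 2 * h%:R + 3 :> R.
    by rewrite -natrM -natrD; congr _%:R; lia.
  rewrite -mul2n natrM -(addn2 h) natrD in H1 H2 * => H3.
  have : 0 <= h%:R :> R by []. lra.
have -> : N.+2 = h.+1.*2 by rewrite doubleS -Nh.
have := step h.+1; have : psi h.+1 <= 4 * h.+1%:R.
  by apply: IHN; rewrite -Nh -addnn; lia.
by rewrite -muln2 natrM; have : 0 <= h.+1%:R :> R by []; lra.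
Qed.

(** After multiplication by [N], replacing [N %/ d] by the exact quotient in [sum_ln_mangoldt] can
    only increase the sum. *)
Lemma mertens_lower N : (0 < N)%N ->
  ln N%:R - 1 <= \sum_(1 <= d < N.+1) mangoldt d / d%:R.
Proof.
move=> N0; have N0' : 0 < N%:R :> R by rewrite ltr0n.
rewrite -(ler_pM2l N0') mulrBr mulr1 (le_trans (sum_ln_ge N)) //.
rewrite sum_ln_mangoldt mulr_sumr; apply: ler_sum_nat => d /andP[d0 _].
rewrite mulrCA ler_wpM2l ?mangoldt_ge0 // ler_pdivlMr ?ltr0n //.
by rewrite -natrM ler_nat leq_trunc_div.
Qed.

(** Here the rounding costs at most [mangoldt d] for each [d], in total [psi N <= 4 N]. *)
Lemma mertens_upper N : (0 < N)%N ->
  \sum_(1 <= d < N.+1) mangoldt d / d%:R <= ln N%:R + 4.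
Proof.
move=> N0; have N0' : 0 < N%:R :> R by rewrite ltr0n.
rewrite -(ler_pM2l N0') mulrDr.
apply: (@le_trans _ _ (\sum_(1 <= n < N.+1) ln n%:R + psi N)); last first.
  by rewrite lerD ?sum_ln_le // mulrC psi_le_linear.
rewrite sum_ln_mangoldt /psi -big_split mulr_sumr /=.
apply: ler_sum_nat => d /andP[d0 _].
rewrite mulrCA -[X in _ + X]mulr1 -mulrDr ler_wpM2l ?mangoldt_ge0 //.
rewrite ler_pdivrMr ?ltr0n //.
by rewrite natr1 -natrM ler_nat ltnW // -ltn_divLR.
Qed.
End Mangoldt.

(** * Contribution of proper prime powers *)

Section PrimePowers.
Variable R : realType.

Lemma sum_geometric2 (x : R) K : 1 < x ->
  \sum_(2 <= k < K.+2) x ^- k = (1 - x ^- K) / (x * (x - 1)).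
Proof.
move=> x1; have x0 : x != 0 by rewrite gt_eqF // (lt_trans ltr01).
have x10 : x - 1 != 0 by rewrite subr_eq0 gt_eqF.
elim: K => [|K IHK]; first by rewrite big_nil expr0 invr1 subrr mul0r.
rewrite big_nat_recr //= IHK !exprS.
have xK0 : x ^+ K != 0 by rewrite expf_neq0.
by field; rewrite x0 x10 xK0.
Qed.

(** The correction [(ln N + 2) / N], close to the tail integral of [ln x / x ^ 2], closes the
    induction: its decrease from [N] to [N + 1] dominates the new term. *)
Lemma sum_ln_telescope N : (0 < N)%N ->
  \sum_(2 <= n < N.+1) ln n%:R / (n%:R * (n%:R - 1))
    <= 2 - (ln N%:R + 2) / N%:R :> R.
Proof.
elim: N => // N IHN _; have [->|N0] := posnP N.
  by rewrite big_nil ln1 add0r divr1 subrr.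
rewrite big_nat_recr //= -lerBrDr (le_trans (IHN N0)) //.
have N0' : 0 < N%:R :> R by rewrite ltr0n.
have N1 : 1 <= N%:R :> R by rewrite ler1n.
have N2 : N%:R + 1 != 0 :> R by rewrite gt_eqF // addr_gt0.
rewrite -subr_ge0 -(@natr1 _ N) addrK.
set a := ln N%:R; set b := ln (N%:R + 1).
have ab : b <= a + N%:R^-1 by rewrite /b natr1 lnS_le.
have -> : 2 - (b + 2) / (N%:R + 1) - b / ((N%:R + 1) * N%:R) -
   (2 - (a + 2) / N%:R) = (2 - (N%:R + 1) * (b - a)) / (N%:R * (N%:R + 1)).
  by field; rewrite N2 gt_eqF.
apply: divr_ge0; last by rewrite mulr_ge0 // ?addr_ge0 // ltW.
rewrite subr_ge0; apply: (@le_trans _ _ ((N%:R + 1) * N%:R^-1)).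
  by rewrite ler_wpM2l ?addr_ge0 ?lerBlDl // ltW.
by rewrite ler_pdivrMr // mulr_natl mulr2n lerD2l.
Qed.

(* Prime powers [p ^ k] with [2 <= k] contribute a bounded amount. *)
Lemma sum_mangoldt_le_primes (h : nat -> R) N :
  (forall n, 0 <= h n <= 1) ->
  \sum_(1 <= n < N.+1) mangoldt R n * (h n / n%:R)
    <= \sum_(1 <= p < N.+1 | prime p) ln p%:R * (h p / p%:R) + 2.
Proof.
move=> h01; have [->|N0] := posnP N.
  by rewrite !big_nil add0r.
have h0 n : 0 <= h n by case/andP: (h01 n).
have h1 n : h n <= 1 by case/andP: (h01 n).
rewrite (sum_mangoldt N (fun n => h n / n%:R)).
apply: (@le_trans _ _ (\sum_(1 <= p < N.+1 | prime p)
    (ln p%:R * (h p / p%:R) + ln p%:R / (p%:R * (p%:R - 1))))).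
  rewrite big_nat_cond [leRHS]big_nat_cond.
  apply: ler_sum => p /andP[/andP[p0 pN] pp].
  rewrite big_mkcond big_ltn //= expn1 -ltnS pN lerD2l.
  have p1 : 1 < p%:R :> R by rewrite ltr1n prime_gt1.
  apply: (@le_trans _ _ (\sum_(2 <= k < N.-1.+2) ln p%:R * p%:R ^- k)).
    rewrite prednK //; apply: ler_sum => k _.
    have pk : 0 <= ln p%:R * p%:R ^- k :> R.
      by rewrite mulr_ge0 ?ln_nat_ge0 // invr_ge0 exprn_ge0.
    case: ifP => // _; rewrite natrX ler_wpM2l ?ln_nat_ge0 //.
    by rewrite ler_piMl // invr_ge0 exprn_ge0.
  rewrite -mulr_sumr sum_geometric2 // ler_wpM2l ?ln_nat_ge0 //.
  rewrite ler_piMl //.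
    by rewrite invr_ge0 mulr_ge0 // subr_ge0 ltW.
rewrite big_split lerD2l /= big_mkcond big_ltn //= add0r.
have := sum_ln_telescope N0; have : 0 <= (ln N%:R + 2) / N%:R :> R.
  by rewrite mulr_ge0 ?invr_ge0 // addr_ge0 ?ln_nat_ge0.
set s := \sum_(_ <= _ < _) _; set s' := \sum_(_ <= _ < _) _ => H1 H2.
suff : s' <= s by lra.
apply: ler_sum_nat => n /andP[n2 _]; case: ifP => // _.
by rewrite mulr_ge0 ?ln_nat_ge0 // invr_ge0 mulr_ge0 // subr_ge0 ler1n ltnW.
Qed.
End PrimePowers.

(** The divisors of [p * n] divisible by [p] are the [p * d] with [d] dividing [n]; the others are
    coprime to [p], hence divide [n]. *)
Lemma sum_divisors_peel (V : nmodType) (F : nat -> V) N p n :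
  prime p -> (0 < n)%N -> (p * n <= N)%N ->
  \sum_(1 <= d < N.+1 | (d %| p * n)%N) F d =
  \sum_(1 <= d < N.+1 | (d %| n)%N) F (p * d)%N +
  \sum_(1 <= d < N.+1 | (d %| n)%N && ~~ (p %| d)%N) F d.
Proof.
move=> pp n0 pnN; have p0 := prime_gt0 pp.
rewrite (bigID (fun d => p %| d)%N) /=; congr (_ + _).
  under eq_bigl do rewrite andbC.
  rewrite big_mkcondr sum_multiples //=.
  under eq_bigr do rewrite dvdn_pmul2l //.
  rewrite -big_mkcond [LHS](big_nat_widen _ _ N.+1) /=; last first.
    by rewrite ltnS leq_div.
  apply: eq_bigl => d; apply: andb_idr => dn.
  rewrite ltnS leq_divRL // mulnC (leq_trans _ pnN) // leq_mul2l.
  by rewrite (dvdn_leq n0 dn) orbT.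
apply: eq_bigl => d; case: (boolP (p %| d)%N) => [|pd]; rewrite ?andbF //.
by rewrite !andbT Gauss_dvdr // coprime_sym prime_coprime.
Qed.

(** * Moebius inversion *)

Section Moebius.
Variable R : realType.

Definition moebius_factor (k : nat) : R :=
  if k is k'.+1 then if k' is _.+1 then 0 else -1 else 1.

(* Agrees with the Moebius function on the integers [1, ..., N]. *)
Definition moebius N n : R :=
  \prod_(p < N.+1 | prime p) moebius_factor (logn p n).

Lemma moebius_norm N n : `|moebius N n| <= 1.
Proof.
rewrite /moebius normr_prod; apply: prodr_ile1 => p _.
rewrite normr_ge0 /=; case: (logn p n) => [|[|k]] /=; rewrite ?normrN ?normr1 ?normr0 //.
Qed.

Lemma moebius1 N : moebius N 1 = 1.
Proof. by rewrite /moebius big1 // => p _; rewrite logn1. Qed.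

Lemma moebius_mul_prime N p d : prime p -> (p <= N)%N -> (0 < d)%N ->
  moebius N (p * d) = if (p %| d)%N then 0 else - moebius N d.
Proof.
move=> pp pN d0; have p0 := prime_gt0 pp.
have pN' : (p < N.+1)%N by [].
rewrite /moebius (bigD1 (Ordinal pN')) //= lognM // (logn_prime p pp) eqxx.
rewrite [X in - X](bigD1 (Ordinal pN')) //=.
have -> : \prod_(q < N.+1 | prime q && (q != Ordinal pN'))
    moebius_factor (logn q (p * d)) =
  \prod_(q < N.+1 | prime q && (q != Ordinal pN')) moebius_factor (logn q d).
  apply: eq_bigr => q /andP[pq qp]; rewrite lognM // (logn_prime q pp).
  by rewrite (negbTE (_ : q != p :> nat)).
case: ifPn => pd; last by rewrite lognE (negbTE pd) andbF andbF /= mulN1r mul1r.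
by rewrite lognE pp d0 pd /= mul0r.
Qed.

(** With [p] the least prime factor of [n], each divisor of [n / p] prime to [p] cancels against its
    multiple by [p], and multiples of [p ^ 2] contribute 0. *)
Lemma sum_moebius N n : (0 < n <= N)%N ->
  \sum_(1 <= d < N.+1 | (d %| n)%N) moebius N d = (n == 1%N)%:R.
Proof.
move=> /andP[n0 nN]; have [->|n1] := eqVneq n 1%N.
  under eq_bigl do rewrite dvdn1.
  by rewrite big_nat1_eq /= ltnS (leq_trans n0 nN) moebius1.
have pp : prime (pdiv n) by rewrite pdiv_prime // ltn_neqAle eq_sym n1.
have pN : (pdiv n <= N)%N by rewrite (leq_trans _ nN) // pdiv_leq.
set p := pdiv n in pp pN.
have nE : n = (p * (n %/ p))%N by rewrite mulnC divnK // pdiv_dvd.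
have m0 : (0 < n %/ p)%N by rewrite divn_gt0 ?prime_gt0 // pdiv_leq.
rewrite {1}nE sum_divisors_peel // -?nE //=.
rewrite [X in X + _]big_nat_cond.
rewrite (eq_bigr (fun d => if ~~ (p %| d)%N then - moebius N d else 0)); last first.
  move=> d /andP[/andP[d0 _] _]; rewrite moebius_mul_prime //.
  by case: (p %| d)%N.
by rewrite -big_nat_cond -big_mkcondr sumrN addNr.
Qed.

(** Inversion of [ln_mangoldt]: after expanding the logarithm, the coefficient of [mangoldt e] is
    the sum of [moebius] over the divisors of [n / e], which singles out [e = n]. *)
Lemma moebius_ln N n : (0 < n <= N)%N ->
  \sum_(1 <= d < N.+1 | (d %| n)%N) moebius N d * ln (n %/ d)%:R = mangoldt R n.
Proof.
move=> n0N; have /andP[n0 nN] := n0N.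
rewrite (eq_bigr (fun d => \sum_(1 <= e < N.+1 | (e %| n %/ d)%N)
    moebius N d * mangoldt R e)); last first.
  move=> d dn; rewrite -mulr_sumr -ln_mangoldt //.
  rewrite divn_gt0 ?(dvdn_gt0 n0 dn) // dvdn_leq //=.
  by rewrite (leq_trans (leq_div _ _)).
rewrite (exchange_big_dep_nat (fun e => e %| n)%N) /=; last first.
  move=> d e _ _ dn /dvdn_trans; apply.
  by rewrite dvdn_divLR // ?dvdn_mulr ?(dvdn_gt0 n0 dn).
rewrite big_nat_cond (eq_bigr (fun e => (e == n)%:R * mangoldt R e)); last first.
  move=> e /andP[/andP[e0 _] en].
  rewrite -mulr_suml; congr (_ * _).
  have -> : (e == n) = (n %/ e == 1)%N by rewrite [RHS]eq_sym eqn_div // mul1n.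
  rewrite -(sum_moebius (N := N)); last first.
    by rewrite divn_gt0 // dvdn_leq //= (leq_trans (leq_div _ _)).
  apply: eq_bigl => d; apply/andP/idP => [[dn]|den].
    by rewrite !dvdn_divRL // mulnC.
  move: den; rewrite dvdn_divRL // => den.
  have dn : (d %| n)%N by rewrite (dvdn_trans _ den) // dvdn_mulr.
  by split=> //; rewrite dvdn_divRL // mulnC.
rewrite -big_nat_cond.
under eq_bigr do rewrite mulr_natl mulrb.
rewrite -big_mkcondr /=.
rewrite (eq_bigl (fun e => e == n)); last first.
  by move=> e; apply: andb_idl => /eqP ->.
by rewrite big_nat1_eq n0 ltnS nN.
Qed.

End Moebius.

(** * Divisor sums of a real character *)

Section Lambert.
Variables (R : realType) (chi : nat -> R).
Hypothesis chi1 : chi 1 = 1.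
Hypothesis chiM : forall a b, chi (a * b)%N = chi a * chi b.
Hypothesis chi_val : forall n, [\/ chi n = 0, chi n = 1 | chi n = -1].

(** For [0 < n <= N], the coefficient of [t ^ n] in the Lambert series of [chi]. *)
Let rsum N n : R := \sum_(1 <= d < N.+1 | (d %| n)%N) chi d.

Lemma rsum_prime_power N p n a : prime p -> ~~ (p %| n)%N -> (0 < n)%N ->
  (p ^ a * n <= N)%N ->
  rsum N (p ^ a * n) = (\sum_(i < a.+1) chi p ^+ i) * rsum N n.
Proof.
move=> pp pn n0; elim: a => [|a IHa] aN.
  by rewrite big_ord1 expr0 mul1r expn0 mul1n.
have pa0 : (0 < p ^ a)%N by rewrite expn_gt0 prime_gt0.
have aN' : (p ^ a * n <= N)%N.
  by rewrite (leq_trans _ aN) // leq_mul2r leq_pexp2l ?orbT ?prime_gt0.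
rewrite expnS -mulnA /rsum sum_divisors_peel ?muln_gt0 ?pa0 //; last first.
  by rewrite mulnA -expnS.
under eq_bigr do rewrite chiM.
have := IHa aN'; rewrite -mulr_sumr /rsum => ->.
rewrite [in RHS]big_ord_recl expr0 mulrDl mul1r addrC.
congr (_ + _).
  apply: eq_bigl => d; apply/andP/idP => [[dn pd]|dn].
    by move: dn; rewrite Gauss_dvdr // coprimeXr // coprime_sym prime_coprime.
  split; first by rewrite dvdn_mull.
  by apply: contra pn => /dvdn_trans; apply.
rewrite mulrA; congr (_ * _); rewrite mulr_sumr.
apply: eq_bigr => i _.
by rewrite -exprS.
Qed.

(** Strip off the full power [p ^ a] of the least prime factor. Its factor is 1 if [chi p = 0],
    [a + 1] if [chi p = 1], and 1 or 0 by the parity of [a] if [chi p = -1]. *)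
Lemma rsum_ge0 N n : (0 < n <= N)%N ->
  0 <= rsum N n /\ ((forall p, ~~ odd (logn p n)) -> 1 <= rsum N n).
Proof.
elim/ltn_ind: n => n IHn /andP[n0 nN]; have [->|n1] := eqVneq n 1%N.
  rewrite /rsum; under eq_bigl do rewrite dvdn1.
  by rewrite big_nat1_eq /= ltnS (leq_trans n0 nN) chi1.
have pp : prime (pdiv n) by rewrite pdiv_prime // ltn_neqAle eq_sym n1.
set p := pdiv n in pp; set a := logn p n; set m := (n`_p^')%N.
have nE : n = (p ^ a * m)%N by rewrite -p_part partnC.
have m0 : (0 < m)%N by rewrite part_gt0.
have pm : ~~ (p %| m)%N.
  by rewrite -prime_coprime // (@pnat_coprime p) ?pnat_id // part_pnat.
have a0 : (0 < a)%N by rewrite logn_gt0 mem_primes pp n0 pdiv_dvd.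
have mn : (m < n)%N.
  by rewrite [X in (_ < X)%N]nE ltn_Pmull // -(exp1n a) ltn_exp2r // prime_gt1.
have mN : (m <= N)%N by rewrite (leq_trans (ltnW mn)).
have [|A0 A1] := IHn m mn; first by rewrite m0 mN.
have -> : rsum N n = (\sum_(i < a.+1) chi p ^+ i) * rsum N m.
  by rewrite {1}nE rsum_prime_power // -nE.
have [c0 c1] : 0 <= \sum_(i < a.+1) chi p ^+ i /\
    (~~ odd a -> 1 <= \sum_(i < a.+1) chi p ^+ i).
  have [chi0|chi_1|chi_1] := chi_val p.
  - rewrite big_ord_recl expr0 big1 ?addr0 ?lexx ?ler01 // => i _.
    by rewrite chi0 exprS mul0r.
  - rewrite big_ord_recl expr0; under eq_bigr do rewrite chi_1 expr1n.
    by rewrite lerDl sumr_ge0 // addr_ge0 ?sumr_ge0.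
  - have -> : \sum_(i < a.+1) chi p ^+ i = (~~ odd a)%:R.
      rewrite chi_1; elim: (a) => [|b IHb]; first by rewrite big_ord1 expr0.
      rewrite big_ord_recr /= IHb -signr_odd /=.
      by case: (odd b); rewrite /= ?expr0 ?expr1 ?add0r ?subrr.
    by split=> // ->.
split; first by rewrite mulr_ge0.
move=> nsq; rewrite -[1]mulr1 ler_pM ?c1 //; first exact: nsq.
apply: A1 => q; have [->|qp] := eqVneq q p.
  by rewrite lognE (negbTE pm) !andbF.
have := nsq q; rewrite nE lognM ?expn_gt0 ?(prime_gt0 pp) //.
by rewrite lognX (logn_prime _ pp) (negbTE qp) muln0.
Qed.

Lemma rsum_square N j : (0 < j)%N -> (j ^ 2 <= N)%N -> 1 <= rsum N (j ^ 2).
Proof.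
move=> j0 jN; have [] := @rsum_ge0 N (j ^ 2) _.
  by rewrite expn_gt0 j0 jN.
by move=> _; apply=> p; rewrite lognX mul2n odd_double.
Qed.

(** Only the squares [j ^ 2] with [1 <= j <= J] are kept; each contributes at least [t ^ (J ^ 2)],
    and the other terms are nonnegative. *)
Lemma sum_rsum_ge (t : R) J N : 0 <= t <= 1 -> (J ^ 2 <= N)%N ->
  J%:R * t ^+ (J ^ 2) <= \sum_(1 <= n < N.+1) rsum N n * t ^+ n.
Proof.
move=> /andP[t0 t1] JN.
suff : forall j, (j <= J)%N ->
    j%:R * t ^+ (J ^ 2) <= \sum_(1 <= n < (j ^ 2).+1) rsum N n * t ^+ n.
  move/(_ J (leqnn _)) => /le_trans; apply.
  rewrite [leRHS](big_cat_nat _ (n := (J ^ 2).+1)) //= lerDl.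
  rewrite big_nat_cond sumr_ge0 // => n /andP[/andP[nJ nN] _].
  rewrite mulr_ge0 ?exprn_ge0 //; have [] // := @rsum_ge0 N n _.
  by rewrite (leq_ltn_trans _ nJ).
elim=> [|j IHj] jJ; first by rewrite big_nil mul0r.
have jS : (j ^ 2 < j.+1 ^ 2)%N by rewrite ltn_exp2r.
have jN : (j.+1 ^ 2 <= N)%N by rewrite (leq_trans _ JN) // leq_exp2r.
rewrite (big_cat_nat _ (n := (j ^ 2).+1)) //=; last by rewrite ltnW // ltnS.
rewrite -natr1 mulrDl mul1r lerD ?IHj //; first exact: ltnW.
rewrite big_nat_recr //= -[leLHS]add0r lerD //.
  rewrite big_nat_cond sumr_ge0 // => n /andP[/andP[nJ nN] _].
  rewrite mulr_ge0 ?exprn_ge0 //; have [] // := @rsum_ge0 N n _.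
  by rewrite (leq_ltn_trans _ nJ) // (leq_trans _ jN) // ltnW.
apply: (@le_trans _ _ (t ^+ (j.+1 ^ 2))).
  by apply: ler_wiXn2l => //; rewrite leq_exp2r.
by rewrite ler_peMl ?exprn_ge0 // rsum_square.
Qed.
End Lambert.

(** * Summation by parts *)

Section Abel.
Variable C : numDomainType.
Implicit Types (f b : nat -> C).

Lemma abel_summation f b a N : (a <= N)%N ->
  let X n := \sum_(0 <= i < n) f i in
  \sum_(a <= n < N) f n * b n =
  X N * b N - X a * b a + \sum_(a <= n < N) X n.+1 * (b n - b n.+1).
Proof.
move=> /subnKC <- X; elim: (N - a)%N => [|k IHk].
  by rewrite addn0 !big_geq // subrr addr0.
rewrite addnS !big_nat_recr ?leq_addr //= IHk /X big_nat_recr //=.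
ring.
Qed.

(** The three pieces of the summation by parts are at most [M * b N], [M * b a] and, by telescoping,
    [M * (b a - b N)]. The general [C] serves both real and complex characters. *)
Lemma abel_bound f b M a N :
  (forall n, `|\sum_(0 <= i < n) f i| <= M) ->
  (forall n, (a <= n)%N -> b n.+1 <= b n) ->
  (forall n, (a <= n)%N -> 0 <= b n) ->
  (a <= N)%N -> `|\sum_(a <= n < N) f n * b n| <= 2 * M * b a.
Proof.
move=> fM b_dec b_ge0 aN; rewrite abel_summation //.
apply: (@le_trans _ _ (M * b N + M * b a + M * (b a - b N))); last first.
  rewrite le_eqVlt; apply/orP; left; apply/eqP; ring.
rewrite (le_trans (ler_normD _ _)) // lerD //.
  rewrite (le_trans (ler_normB _ _)) // !normrM.
  by rewrite lerD // ler_pM // ger0_norm ?b_ge0.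
have -> : b a - b N = \sum_(a <= n < N) (b n - b n.+1).
  rewrite -[LHS]opprB -telescope_sumr // -sumrN.
  by apply: eq_bigr => n _; rewrite opprB.
rewrite mulr_sumr (le_trans (ler_norm_sum _ _ _)) // ler_sum_nat // => n /andP[an _].
by rewrite normrM ler_pM // ger0_norm ?subr_ge0 ?b_dec.
Qed.
End Abel.

(** * Weights comparing a Lambert series with L(1, chi) *)

Section Monsky.
Variables (R : realType) (t : R).
Hypothesis t01 : 0 < t < 1.

Let t0 : 0 < t. Proof. by case/andP: t01. Qed.
Let t1 : t < 1. Proof. by case/andP: t01. Qed.
Let tX n : 0 < t ^+ n. Proof. exact: exprn_gt0. Qed.

Definition geom n : R := \sum_(i < n) t ^+ i.

Lemma geomS n : geom n.+1 = geom n + t ^+ n.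
Proof. by rewrite /geom big_ord_recr. Qed.

Lemma geomSl n : geom n.+1 = 1 + t * geom n.
Proof.
rewrite /geom big_ord_recl expr0 mulr_sumr; congr (_ + _).
by apply: eq_bigr => i _; rewrite exprS.
Qed.

Lemma geomE n : (1 - t) * geom n = 1 - t ^+ n.
Proof.
elim: n => [|n IHn]; first by rewrite /geom big_ord0 mulr0 expr0 subrr.
rewrite geomS mulrDr IHn exprS; ring.
Qed.

Lemma geom_ge1 n : (0 < n)%N -> 1 <= geom n.
Proof.
case: n => // n _; rewrite /geom big_ord_recl expr0 lerDl sumr_ge0 // => i _.
exact/ltW.
Qed.

Lemma geom_gt0 n : (0 < n)%N -> 0 < geom n.
Proof. by move=> n0; rewrite (lt_le_trans ltr01) // geom_ge1. Qed.

Lemma geom_ge n : n%:R * t ^+ n <= geom n.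
Proof.
have -> : n%:R * t ^+ n = \sum_(i < n) t ^+ n.
  by rewrite sumr_const card_ord mulr_natl.
apply: ler_sum => i _; apply: ler_wiXn2l; [exact: ltW|exact: ltW|exact: ltnW].
Qed.

Lemma geom_le n : geom n <= (1 - t)^-1.
Proof.
by rewrite -[leRHS]mul1r ler_pdivlMr ?subr_gt0 // mulrC geomE gerBl ltW.
Qed.

Lemma geom_mulS n : n%:R * n.+1%:R * t ^+ n <= geom n * geom n.+1.
Proof.
(* Pair the exponents [i + j] and [2 n - 1 - (i + j)]. *)
have E (u : 'I_n -> 'I_n) (v : 'I_n.+1 -> 'I_n.+1) : injective u -> injective v ->
    geom n * geom n.+1 = \sum_(i < n) \sum_(j < n.+1) t ^+ (u i + v j).
  move=> iu iv; rewrite /geom (reindex_inj iu) (reindex_inj iv) /= mulr_suml.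
  apply: eq_bigr => i _; rewrite mulr_sumr; apply: eq_bigr => j _.
  by rewrite exprD.
have -> : geom n * geom n.+1 =
    \sum_(i < n) \sum_(j < n.+1) (t ^+ (i + j) + t ^+ (rev_ord i + rev_ord j)) / 2.
  under eq_bigr do rewrite -mulr_suml big_split /=.
  rewrite -mulr_suml big_split /= -(E id id) // -(E _ _ rev_ord_inj rev_ord_inj).
  by field.
have -> : n%:R * n.+1%:R * t ^+ n = \sum_(i < n) \sum_(j < n.+1) t ^+ n.
  by rewrite !sumr_const !card_ord -mulrnA -natrM mulr_natl mulnC.
apply: ler_sum => i _; apply: ler_sum => j _.
rewrite ler_pdivlMr //; set a := (i + j)%N; set b := (rev_ord i + rev_ord j)%N.
have ab : (a + b.+1 = n + n)%N.
  by rewrite /a /b /=; have := ltn_ord i; have := ltn_ord j; lia.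
(* The paired exponents add up to the odd number [2 n - 1]; passing from [b] to [b + 1] only lowers
   the power and makes the sum [2 n], where AM-GM applies. *)
have tb : t ^+ b.+1 <= t ^+ b by apply: ler_wiXn2l; rewrite ?ltW.
suff : t ^+ n * 2 <= t ^+ a + t ^+ b.+1 by lra.
have key x y : (x <= y)%N -> (x + y = n + n)%N -> t ^+ n * 2 <= t ^+ x + t ^+ y.
  move=> xy xyn; have [k nE] : exists k, n = (x + k)%N by exists (n - x)%N; lia.
  have -> : y = (x + k + k)%N by lia.
  rewrite nE !exprD -subr_ge0.
  have -> : t ^+ x + t ^+ x * t ^+ k * t ^+ k - t ^+ x * t ^+ k * 2 =
     t ^+ x * (1 - t ^+ k) ^+ 2 by ring.
  by rewrite mulr_ge0 ?sqr_ge0 // ltW.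
have [le|le] := leqP a b.+1; first exact: key.
by rewrite addrC key // 1?ltnW // addnC.
Qed.

(** Equals [1 / n - (1 - t) t ^ n / (1 - t ^ n)], so summing [chi] against it compares [L(1, chi)]
    with [1 - t] times the Lambert series of [chi]. *)
Definition lambert_gap n : R := n%:R^-1 - t ^+ n / geom n.

Lemma lambert_gap_ge0 n : (1 <= n)%N -> 0 <= lambert_gap n.
Proof.
move=> n0; rewrite subr_ge0 ler_pdivrMr ?geom_gt0 // mulrC ler_pdivlMr ?ltr0n //.
by rewrite mulrC geom_ge.
Qed.

(** The difference of consecutive terms is [1 / (n (n + 1)) - t ^ n / (geom n * geom n.+1)], so
    [geom_mulS] is exactly what is needed. *)
Lemma lambert_gap_dec n : (1 <= n)%N -> lambert_gap n.+1 <= lambert_gap n.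
Proof.
move=> n0; have gn := geom_gt0 n0; have gS := geom_gt0 (ltn0Sn n).
have n0' : 0 < n%:R :> R by rewrite ltr0n.
have nS0 : 0 < n.+1%:R :> R by [].
rewrite -subr_ge0 /lambert_gap.
have -> : n%:R^-1 - t ^+ n / geom n - (n.+1%:R^-1 - t ^+ n.+1 / geom n.+1) =
    (n%:R * n.+1%:R)^-1 - t ^+ n / (geom n * geom n.+1).
  move: gS nS0; rewrite geomSl -natr1 exprS => gS nS0; field.
  by rewrite !gt_eqF.
rewrite subr_ge0 ler_pdivrMr ?mulr_gt0 // mulrC ler_pdivlMr ?mulr_gt0 //.
by rewrite mulrC geom_mulS.
Qed.
End Monsky.

Lemma bernoulli (R : realDomainType) (x : R) n :
  0 <= x <= 1 -> 1 - n%:R * x <= (1 - x) ^+ n.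
Proof.
move=> /andP[x0 x1]; elim: n => [|n IHn]; first by rewrite mul0r subr0.
have h : (1 - x) * (1 - n%:R * x) <= (1 - x) * (1 - x) ^+ n.
  by rewrite ler_wpM2l // subr_ge0.
rewrite exprS (le_trans _ h) // -natr1.
have : 0 <= n%:R * x * x by rewrite !mulr_ge0.
by move=> ?; lra.
Qed.

(** * Nonvanishing of L(1, chi) for real chi *)

Section RealCharacter.
Variables (R : realType) (chi : nat -> R).
Hypothesis chi1 : chi 1 = 1.
Hypothesis chiM : forall a b, chi (a * b)%N = chi a * chi b.
Hypothesis chi_val : forall n, [\/ chi n = 0, chi n = 1 | chi n = -1].

(* Monsky's argument: the Lambert series of a real character is at least
   sum t ^ (j ^ 2), which is unbounded as t tends to 1; if L(1, chi) = 0 then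
   subtracting L(1, chi) / (1 - t) leaves a sum of chi with monotone weights,
   which is bounded. *)
Lemma real_character_nonvanishing (M K : R) :
  (forall n, `|\sum_(0 <= i < n) chi i| <= M) ->
  (forall n, (0 < n)%N -> `|\sum_(1 <= i < n.+1) chi i / i%:R| <= K / n%:R) ->
  False.
Proof.
move=> chi_bound vanish.
have M0 : 0 <= M by apply: le_trans (chi_bound 0%N).
have K0 : 0 <= K.
  by have := vanish 1%N isT; rewrite divr1; apply: le_trans.
(* The argument for sums cut at [N]. The three error terms are the partial sum of [L(1, chi)], the
   Abel bound with first weight [lambert_gap t 1 = 1 - t], and the tails of the inner geometric
   series. *)
have main (t : R) J N : 0 < t < 1 -> (0 < N)%N -> (J ^ 2 <= N)%N ->
    (1 - t) * (J%:R * t ^+ (J ^ 2))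
      <= K / N%:R + 2 * M * (1 - t) + N%:R * t ^+ N.
  move=> t01 N0 JN; have /andP[t0 t1] := t01.
  have tX n : 0 < t ^+ n by exact: exprn_gt0.
  have ge := sum_rsum_ge chi1 chiM chi_val _ JN.
  apply: (le_trans (ler_wpM2l _ (ge t _))); [by rewrite subr_ge0 ltW|by rewrite !ltW|].
  have -> : \sum_(1 <= n < N.+1)
      (\sum_(1 <= d < N.+1 | (d %| n)%N) chi d) * t ^+ n =
      \sum_(1 <= d < N.+1) chi d * \sum_(1 <= e < (N %/ d).+1) t ^+ (d * e).
    under [RHS]eq_bigr do rewrite mulr_sumr.
    rewrite -(sum_divisors N (fun d e => chi d * t ^+ (d * e))).
    apply: eq_bigr => n _; rewrite mulr_suml; apply: eq_bigr => d dn.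
    by rewrite mulnC divnK.
  have powsum (y : R) q : (1 - y) * \sum_(1 <= e < q.+1) y ^+ e = y - y ^+ q.+1.
    elim: q => [|q IHq]; first by rewrite big_nil mulr0 subrr.
    rewrite big_nat_recr //= mulrDr IHq [y ^+ q.+2]exprS; ring.
  have -> : (1 - t) * \sum_(1 <= d < N.+1)
       chi d * \sum_(1 <= e < (N %/ d).+1) t ^+ (d * e) =
     \sum_(1 <= d < N.+1) chi d / d%:R
     - \sum_(1 <= d < N.+1) chi d * lambert_gap t d
     - \sum_(1 <= d < N.+1) chi d * (t ^+ (d * (N %/ d).+1) / geom t d).
    rewrite mulr_sumr -!sumrB big_nat_cond [RHS]big_nat_cond.
    apply: eq_bigr => d /andP[/andP[d0 _] _].
    have gd := geom_gt0 t01 d0.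
    have := powsum (t ^+ d) (N %/ d)%N; rewrite -(geomE t d) exprM.
    under eq_bigr do rewrite -exprM.
    set s := \sum_(_ <= _ < _) _ => hs.
    have {hs} : (1 - t) * s = (t ^+ d - t ^+ d ^+ (N %/ d).+1) / geom t d.
      by rewrite -hs; field; by rewrite gt_eqF.
    rewrite mulrCA => ->; rewrite /lambert_gap; ring.
  apply: (le_trans (ler_norm _)).
  apply: (le_trans (ler_normB _ _)); apply: lerD.
    rewrite (le_trans (ler_normB _ _)) // lerD ?vanish //.
    have -> : 1 - t = lambert_gap t 1.
      by rewrite /lambert_gap /geom big_ord1 expr0 expr1 invr1 mulr1.
    by apply: abel_bound => // n; [exact: lambert_gap_dec|exact: lambert_gap_ge0].
  rewrite (le_trans (ler_norm_sum _ _ _)) //.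
  have -> : N%:R * t ^+ N = \sum_(1 <= d < N.+1) t ^+ N.
    by rewrite sumr_const_nat subn1 mulr_natl.
  apply: ler_sum_nat => d /andP[d0 _].
  have chid : `|chi d| <= 1.
    by case: (chi_val d) => ->; rewrite ?normrN ?normr0 ?normr1.
  rewrite normrM -[leRHS]mul1r ler_pM // ger0_norm; last first.
    by rewrite mulr_ge0 ?invr_ge0 // ltW // geom_gt0.
  rewrite ler_pdivrMr ?geom_gt0 // (@le_trans _ _ (t ^+ N)) //.
    by apply: ler_wiXn2l; [exact: ltW|exact: ltW|rewrite ltnW // mulnC -ltn_divLR].
  by rewrite ler_peMr ?geom_ge1 // ltW.
(* With [u = 1 / (2 J ^ 2)] and [t = 1 - u], Bernoulli gives [t ^ (J ^ 2) >= 1 / 2], so the left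
   side of [main] is at least [u J / 2], which exceeds [u (2 M + 2)]. *)
have [J JM] : exists J, 4 * M + 4 < J%:R.
  by exists (Num.truncn (4 * M + 4)).+1; exact: truncnS_gt.
have J0 : (0 < J)%N by rewrite lt0n; apply: contraTneq JM => ->; rewrite -leNgt; lra.
pose u : R := (2 * J%:R ^+ 2)^-1.
have J1 : 1 <= J%:R :> R by rewrite ler1n.
have JJ : 1 <= J%:R ^+ 2 :> R by rewrite exprn_ege1.
have u0 : 0 < u by rewrite invr_gt0; lra.
have u1 : u < 1 by rewrite invf_lt1; lra.
pose t := 1 - u.
have t01 : 0 < t < 1 by rewrite /t; apply/andP; split; lra.
have tJ : 1 / 2 <= t ^+ (J ^ 2).
  apply: le_trans (bernoulli _ _); last by apply/andP; split; lra.
  rewrite natrX /u le_eqVlt; apply/orP; left; apply/eqP; field.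
  by rewrite gt_eqF //; lra.
(* For [N = 2 m'] this makes [K / N] and [N t ^ N] at most [u], so the right side of [main] is at
   most [u (2 M + 2)]. Evenness allows [N t ^ N = 2 (m' t ^ m') ^ 2 / m'], where
   [m' t ^ m' <= 1 / u]. *)
pose B := Num.max (K / u) (2 / u ^+ 3).
have [m mB] : exists m, B < m%:R.
  by exists (Num.truncn B).+1; exact: truncnS_gt.
move: mB; rewrite /B gt_max => /andP[mK mu].
pose m' := maxn m (J ^ 2).
have m'0 : (0 < m')%N by rewrite /m' leq_max expn_gt0 J0 orbT.
have mm' : m%:R <= m'%:R :> R by rewrite ler_nat leq_maxl.
have m'0' : 0 < m'%:R :> R by rewrite ltr0n.
have := main t J m'.*2 t01; rewrite double_gt0 m'0 => /(_ isT).
have -> : (J ^ 2 <= m'.*2)%N.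
  by rewrite (@leq_trans m') ?leq_maxr // -addnn leq_addr.
move=> /(_ isT); have -> : 1 - t = u by rewrite /t; ring.
apply/negP; rewrite -ltNge.
have h1 : K / m'.*2%:R <= u.
  rewrite ler_pdivrMr ?ltr0n ?double_gt0 // mulrC -ler_pdivrMr //.
  by rewrite (le_trans (ltW mK)) // (le_trans mm') // ler_nat -addnn leq_addr.
have h2 : m'.*2%:R * t ^+ m'.*2 <= u.
  have h : m'%:R * t ^+ m' <= u^-1.
    have -> : u = 1 - t by rewrite /t; ring.
    exact: le_trans (geom_ge t01 _) (geom_le t01 _).
  have -> : m'.*2%:R * t ^+ m'.*2 = 2 * (m'%:R * t ^+ m') ^+ 2 / m'%:R.
    rewrite -addnn natrD exprD; field; by rewrite gt_eqF.
  rewrite ler_pdivrMr //; apply: (@le_trans _ _ (2 * u^-1 ^+ 2)).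
    have tm : 0 <= m'%:R * t ^+ m'.
      by rewrite mulr_ge0 // exprn_ge0; case/andP: t01 => /ltW.
    by rewrite ler_pM2l // ler_pXn2r // nnegrE // invr_ge0 ltW.
  have -> : 2 * u^-1 ^+ 2 = u * (2 / u ^+ 3) by field; by rewrite gt_eqF.
  by rewrite ler_pM2l // (le_trans (ltW mu)).
have h3 : J%:R * (1 / 2) <= J%:R * t ^+ (J ^ 2) by rewrite ler_wpM2l.
have h4 : u * (J%:R * (1 / 2)) <= u * (J%:R * t ^+ (J ^ 2)) by rewrite ler_pM2l.
have h5 : u * (4 * M + 4) < u * J%:R by rewrite ltr_pM2l.
have uM : 0 <= u * M by rewrite mulr_ge0 // ltW.
lra.
Qed.
End RealCharacter.

(** * Dirichlet characters *)

Lemma primitive_root_exists (F : closedFieldType) n :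
  n%:R != 0 :> F -> exists z : F, n.-primitive_root z.
Proof.
case: n => [|n] nF; first by rewrite eqxx in nF.
pose p : {poly F} := 'X ^+ n.+1 - 1; have [r Dp] := closed_field_poly_normal p.
rewrite (monicP _) ?monicXnsubC // scale1r in Dp.
have rn1 : all n.+1.-unity_root r by apply/allP=> z; rewrite -root_prod_XsubC -Dp.
have sz_r : (n.+1 < (size r).+1)%N.
  by rewrite -(size_prod_XsubC r id) -Dp size_XnsubC.
have [|z] := hasP (has_prim_root (ltn0Sn n) rn1 _ sz_r); last by exists z.
by rewrite -separable_prod_XsubC -Dp separable_Xn_sub_1.
Qed.

Section DualGroup.
Variables (R : realType) (m : nat).
Hypothesis m1 : (1 < m)%N.

Local Notation C := R[i].
Local Notation U := {unit 'Z_m}.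
(* A multiple of the order of the group of units, and at least 2, so that 'Z_n
   really is Z/n. *)
Let n : nat := (#|[set: U]|).*2.

Let n1 : (1 < n)%N.
Proof. by rewrite /n -addnn (leq_add (cardG_gt0 _) (cardG_gt0 _)). Qed.

Let n_neq0 (F : numFieldType) : n%:R != 0 :> F.
Proof. by rewrite pnatr_eq0 -lt0n (ltnW n1). Qed.

Let w : C := xchoose (@primitive_root_exists C n (n_neq0 _)).
Let prim_w : n.-primitive_root w := xchooseP _.

(** Characters are stored through additive exponents in ['Z_n] rather than values, so that they form
    a finite type that does not depend on the field of values. *)
Definition is_dual (f : {ffun U -> 'Z_n}) :=
  [forall x, forall y, f (x * y)%g == f x + f y].

Definition dual := {f : {ffun U -> 'Z_n} | is_dual f}.

HB.instance Definition _ := Finite.copy dual {f : {ffun U -> 'Z_n} | is_dual f}.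

Lemma dualM (f : dual) x y : val f (x * y)%g = val f x + val f y.
Proof. by move/forallP: (valP f) => /(_ x) /forallP /(_ y) /eqP. Qed.

Lemma dual0_subproof : is_dual 0.
Proof. by apply/forallP => x; apply/forallP => y; rewrite !ffunE addr0. Qed.
Definition dual0 : dual := Sub 0 dual0_subproof.

Lemma dualN_subproof (f : dual) : is_dual (- val f).
Proof. by apply/forallP => x; apply/forallP => y; rewrite !ffunE dualM opprD. Qed.
Definition dualN f : dual := Sub (- val f) (dualN_subproof f).

Lemma dualD_subproof (f g : dual) : is_dual (val f + val g).
Proof.
by apply/forallP => x; apply/forallP => y; rewrite !ffunE !dualM addrACA.
Qed.
Definition dualD f g : dual := Sub (val f + val g) (dualD_subproof f g).

(** The irreducible characters over [algC] of the abelian group of units are linear, with trivial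
    common kernel. Exponents relative to a primitive root in [algC] carry one that is not 1 at [u]
    over to [dual]. *)
Lemma dual_separation (u : U) : u != 1%g -> exists f : dual, val f u != 0.
Proof.
move=> u1.
have [z prim_z] := @primitive_root_exists algC n (n_neq0 _).
have [i chi_u] : exists i : Iirr [set: U], 'chi_i u != 1.
  apply/existsP; apply: contraNT u1; rewrite negb_exists => /forallP chi_u.
  have : u \in \bigcap_(i : Iirr [set: U]) cfker 'chi_i.
    2: by rewrite TI_cfker_irr inE.
  apply/bigcapP => i _; rewrite cfkerEirr inE.
  move: (chi_u i); rewrite negbK => /eqP ->.
  by rewrite lin_char1 //; apply/char_abelianP/units_Zp_abelian.
have lin_i : 'chi_i \is a linear_char.
  by apply/char_abelianP/units_Zp_abelian.
have chi_n x : 'chi_i x ^+ n = 1.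
  have /dvdnP[k kn] : (#[x]%g %| n)%N.
    by rewrite /n -muln2 dvdn_mulr // order_dvdG // inE.
  by rewrite kn mulnC exprM lin_char_unity_root ?expr1n ?inE.
pose l x : 'I_n := sval (prim_rootP prim_z (chi_n x)).
have lE x : 'chi_i x = z ^+ l x := svalP (prim_rootP prim_z (chi_n x)).
pose f : {ffun U -> 'Z_n} := [ffun x => (l x)%:R].
have f_dual : is_dual f.
  apply/forallP => x; apply/forallP => y; rewrite !ffunE -natrD.
  apply/eqP/val_inj; rewrite /= !val_Zp_nat //; apply/eqP.
  rewrite -(eq_prim_root_expr prim_z) exprD -!lE lin_charM //; exact: in_setT.
exists (Sub f f_dual); rewrite SubK ffunE.
apply: contra chi_u => /eqP/(congr1 val); rewrite /= val_Zp_nat //= => l0.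
by rewrite lE -(prim_expr_mod prim_z) l0 expr0.
Qed.

Definition dual_eval (f : dual) (x : 'Z_m) : C :=
  if insub x is Some u then w ^+ (val f u : 'Z_n) else 0.

Lemma dual_eval_unit f (u : U) : dual_eval f (val u) = w ^+ (val f u : 'Z_n).
Proof. by rewrite /dual_eval valK. Qed.

Lemma dual_eval_nonunit f x : x \isn't a GRing.unit -> dual_eval f x = 0.
Proof. by move=> xU; rewrite /dual_eval insubF //; apply/negbTE. Qed.

Lemma wD (a b : 'Z_n) : w ^+ (a + b)%R = w ^+ a * w ^+ b.
Proof.
rewrite -exprD -[RHS](prim_expr_mod prim_w); congr (_ ^+ _).
by congr (_ %% _)%N; exact: Zp_cast.
Qed.

Lemma w_eq1 (a : 'Z_n) : (w ^+ a == 1) = (a == 0).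
Proof.
rewrite -(prim_order_dvd prim_w); apply/idP/eqP => [|->]; last exact: dvdn0.
move=> na; apply/val_inj; apply/eqP; rewrite /= eqn0Ngt; apply/negP => a0.
have := dvdn_leq a0 na; apply/negP; rewrite -ltnNge.
by have := ltn_ord a; rewrite [in X in (_ < X)%N -> _]Zp_cast.
Qed.

Lemma w_norm a : `|w ^+ a| = 1.
Proof.
have : `|w| ^+ n == 1 by rewrite -normrX prim_expr_order // normr1.
by rewrite pexpr_eq1 ?normr_ge0 ?(ltnW n1) // normrX => /eqP ->; rewrite expr1n.
Qed.

Lemma dual_evalM f : {morph dual_eval f : x y / x * y}.
Proof.
move=> x y; case: (boolP (x \is a GRing.unit)) => xU; last first.
  by rewrite (dual_eval_nonunit f xU) mul0r dual_eval_nonunit // unitrM (negbTE xU).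
case: (boolP (y \is a GRing.unit)) => yU; last first.
  rewrite (dual_eval_nonunit f yU) mulr0 dual_eval_nonunit //.
  by rewrite unitrM (negbTE yU) andbF.
rewrite -[x]/(val (FinRing.unit 'Z_m xU)) -[y]/(val (FinRing.unit 'Z_m yU)).
by rewrite -FinRing.val_unitM !dual_eval_unit dualM wD.
Qed.

Lemma dual_eval1 f : dual_eval f 1 = 1.
Proof.
have /eqP : val f 1%g + val f 1%g = val f 1%g by rewrite -dualM mulg1.
rewrite -subr_eq0 addrK => /eqP f1.
by rewrite -[1]/(val (1%g : U)) dual_eval_unit f1 expr0.
Qed.

Lemma dual_eval_norm f x : `|dual_eval f x| = (x \is a GRing.unit)%:R.
Proof.
case: (boolP (x \is a GRing.unit)) => xU; last by rewrite dual_eval_nonunit ?normr0.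
by rewrite -[x]/(val (FinRing.unit 'Z_m xU)) dual_eval_unit w_norm.
Qed.

Lemma dual_eval0 x : dual_eval dual0 x = (x \is a GRing.unit)%:R.
Proof.
case: (boolP (x \is a GRing.unit)) => xU; last by rewrite dual_eval_nonunit.
by rewrite -[x]/(val (FinRing.unit 'Z_m xU)) dual_eval_unit SubK ffunE expr0.
Qed.

Lemma dual_evalN f x : dual_eval (dualN f) x = (dual_eval f x)^*%C.
Proof.
case: (boolP (x \is a GRing.unit)) => xU; last by rewrite !dual_eval_nonunit ?rmorph0.
rewrite -[x]/(val (FinRing.unit 'Z_m xU)) !dual_eval_unit SubK ffunE.
set a := val f _; have wa0 : w ^+ a != 0 by rewrite -normr_eq0 w_norm oner_eq0.
apply: (mulfI wa0); rewrite -wD subrr expr0.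
by rewrite -sqr_normc w_norm expr1n.
Qed.

Lemma dualNK : involutive dualN.
Proof. by move=> f; apply: val_inj; rewrite /= opprK. Qed.

Lemma dualN0 : dualN dual0 = dual0.
Proof. by apply: val_inj; rewrite /= oppr0. Qed.

Lemma dual_eval_real f x : dualN f = f ->
  [\/ dual_eval f x = 0, dual_eval f x = 1 | dual_eval f x = -1].
Proof.
move=> fN; case: (boolP (x \is a GRing.unit)) => xU; last first.
  by rewrite dual_eval_nonunit //; constructor 1.
have : dual_eval f x ^+ 2 = 1.
  by rewrite expr2 -{2}fN dual_evalN -sqr_normc dual_eval_norm xU expr1n.
move=> /eqP; rewrite sqrf_eq1 => /orP[] /eqP ->; first by constructor 2.
by constructor 3.
Qed.

(** Multiplication by a unit [u] with [val f u != 0] permutes ['Z_m] and scales the sum by a factor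
    other than 1. *)
Lemma sum_dual_eval f : f != dual0 -> \sum_(x : 'Z_m) dual_eval f x = 0.
Proof.
move=> f0; have [u fu] : exists u, val f u != 0.
  apply/existsP; apply: contraNT f0; rewrite negb_exists => /forallP fu.
  by apply/eqP/val_inj/ffunP => u; rewrite SubK ffunE; apply/eqP; rewrite -[_ == _]negbK.
have eu1 : dual_eval f (val u) != 1 by rewrite dual_eval_unit w_eq1.
apply/eqP; rewrite -(mulIr_eq0 _ (mulIf (_ : dual_eval f (val u) - 1 != 0))) ?subr_eq0 //.
rewrite mulrBr mulr1 subr_eq0; apply/eqP.
rewrite [RHS](reindex_inj (mulrI (valP u))) mulr_suml /=.
by apply: eq_bigr => x _; rewrite dual_evalM mulrC.
Qed.

(** For a unit other than 1, translate the dual by some [g] from [dual_separation]: the sum is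
    scaled by a factor other than 1. *)
Lemma sum_dual x : \sum_(f : dual) dual_eval f x = (#|{: dual}| * (x == 1))%:R.
Proof.
have [->|x1] := eqVneq x 1.
  under eq_bigr do rewrite dual_eval1.
  by rewrite sumr_const muln1.
rewrite muln0; case: (boolP (x \is a GRing.unit)) => xU; last first.
  by rewrite big1 // => f _; rewrite dual_eval_nonunit.
rewrite -[x]/(val (FinRing.unit 'Z_m xU)); set u := FinRing.unit _ _.
have [g gu] : exists f : dual, val f u != 0.
  by apply: dual_separation; apply: contra x1 => /eqP/(congr1 val) /= ->.
have gu1 : w ^+ (val g u : 'Z_n) - 1 != 0.
  by rewrite subr_eq0 w_eq1.
apply/eqP; rewrite -(mulIr_eq0 _ (mulIf gu1)).
rewrite mulrBr mulr1 subr_eq0; apply/eqP.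
have dualD_inj : injective (dualD g).
  by move=> f f' /(congr1 val) /= /addrI /val_inj.
rewrite [RHS](reindex_inj dualD_inj) mulr_suml.
by apply: eq_bigr => f _; rewrite !dual_eval_unit SubK ffunE wD mulrC.
Qed.

End DualGroup.

(** The interface between the group theory and the analysis. In the last clause [b] is an inverse of
    [a] modulo [m], so weighting by [chi i b] selects the class of [a]. *)
Lemma dirichlet_characters (R : realType) m : (1 < m)%N ->
  exists (I : finType) (i0 : I) (inv : I -> I) (chi : I -> nat -> R[i]),
  [/\ [/\ forall i a b, chi i (a * b)%N = chi i a * chi i b,
          forall i, chi i 1%N = 1,
          forall i a, `|chi i a| = (coprime m a)%:R &
          forall a, chi i0 a = (coprime m a)%:R],
      forall i N, i != i0 -> `|\sum_(0 <= k < N) chi i k| <= m%:R,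
      [/\ involutive inv, inv i0 = i0,
          forall i a, chi (inv i) a = (chi i a)^*%C &
          forall i a, inv i = i ->
            [\/ chi i a = 0, chi i a = 1 | chi i a = -1]] &
      (forall k, \sum_i chi i k = (#|I| * (k == 1 %[mod m]))%:R) /\
      forall a, coprime m a -> exists2 b, coprime m b &
        forall k, \sum_i chi i (b * k)%N = (#|I| * (k == a %[mod m]))%:R].
Proof.
move=> m1; have eqZ k a : (k%:R == a%:R :> 'Z_m) = (k == a %[mod m]).
  by rewrite -val_eqE /= !val_Zp_nat.
exists (dual m), (dual0 m), (@dualN m).
exists (fun f k => dual_eval R f k%:R).
split; [split| |split|split].
- by move=> f a b; rewrite natrM dual_evalM.
- by move=> f; rewrite dual_eval1.
- by move=> f a; rewrite dual_eval_norm unitZpE.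
- by move=> a; rewrite dual_eval0 unitZpE.
- move=> f N f0; pose F k := dual_eval R f k%:R.
  (* Full periods sum to 0, so fewer than [m] terms of modulus at most 1 remain. *)
  have period q r : \sum_(0 <= k < q * m + r) F k = \sum_(0 <= k < r) F k.
    elim: q => [|q IHq]; first by rewrite mul0n.
    rewrite mulSn -addnA (big_cat_nat _ (n := m)) ?leq_addr //=.
    have -> : \sum_(0 <= k < m) F k = 0.
      rewrite -{1}(Zp_cast m1) big_mkord -[RHS](sum_dual_eval R f0).
      by apply: eq_bigr => x _; rewrite /F natr_Zp.
    rewrite add0r -{1}[m]add0n big_addn addKn -IHq.
    by apply: eq_bigr => k _; rewrite /F natrD -(Zp_nat_mod m1 m) modnn addr0.
  rewrite (divn_eq N m) -/(F _) period.
  apply: le_trans (ler_norm_sum _ _ _) _.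
  apply: (@le_trans _ _ (\sum_(0 <= k < N %% m) 1)).
    by apply: ler_sum => k _; rewrite dual_eval_norm lern1 leq_b1.
  by rewrite sumr_const_nat subn0 ler_nat ltnW // ltn_mod ltnW.
- exact: dualNK.
- exact: dualN0.
- by move=> f a; rewrite dual_evalN.
- by move=> f a; exact: dual_eval_real.
- by move=> k; rewrite sum_dual -(eqZ k 1%N).
- move=> a am; have aU : (a%:R : 'Z_m) \is a GRing.unit by rewrite unitZpE.
  exists ((a%:R : 'Z_m)^-1 : 'Z_m) => [|k].
    by rewrite -unitZpE // natr_Zp unitrV.
  rewrite sum_dual; congr (_ * nat_of_bool _)%:R.
  rewrite natrM natr_Zp mulrC -(inj_eq (mulIr aU)) divrK // mul1r.
  exact: eqZ.
Qed.

(** * Dirichlet's theorem *)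

Section ComplexModulus.
Variable R : realType.
Implicit Types (z : R[i]) (r : R).

(** The norm of [R[i]] takes its values in [R[i]]; this copy in [R] turns estimates into real linear
    inequalities. *)
Definition cabs z : R := complex.Re `|z|.

Lemma normE z : `|z| = (cabs z)%:C%C.
Proof. by rewrite /cabs normc_def. Qed.

Lemma cabs_le z r : (cabs z <= r) = (`|z| <= r%:C%C).
Proof. by rewrite normE lecR. Qed.

Lemma cabs_ge0 z : 0 <= cabs z.
Proof. by rewrite -ler0c -normE normr_ge0. Qed.

Lemma cabsD z z' : cabs (z + z') <= cabs z + cabs z'.
Proof. by rewrite cabs_le rmorphD /= -!normE ler_normD. Qed.

Lemma cabsB z z' : cabs (z - z') <= cabs z + cabs z'.
Proof. by rewrite cabs_le rmorphD /= -!normE ler_normB. Qed.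

Lemma cabsM z z' : cabs (z * z') = cabs z * cabs z'.
Proof. by apply: (@complexI R); rewrite rmorphM -!normE normrM. Qed.

Lemma cabsR r : cabs r%:C%C = `|r|.
Proof. by rewrite /cabs normc_def /= expr0n addr0 sqrtr_sqr. Qed.

Lemma cabs_sum (I : Type) (s : seq I) (P : pred I) (F : I -> R[i]) :
  cabs (\sum_(i <- s | P i) F i) <= \sum_(i <- s | P i) cabs (F i).
Proof.
rewrite cabs_le rmorph_sum /=.
apply: (le_trans (ler_norm_sum _ _ _)).
by rewrite le_eqVlt; apply/orP; left; apply/eqP/eq_bigr => i _; exact: normE.
Qed.

Lemma Re_le_cabs z : complex.Re z <= cabs z.
Proof.
apply: le_trans (ler_norm _) _; rewrite -lecR -normE; exact: normc_ge_Re.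
Qed.

Lemma Re_ge_cabs z : - cabs z <= complex.Re z.
Proof.
rewrite lerNl; apply: (@le_trans _ _ `|complex.Re z|); last first.
  by rewrite -lecR -normE; exact: normc_ge_Re.
by rewrite -normrN ler_norm.
Qed.

Lemma cabs_conj z : cabs z^*%C = cabs z.
Proof. by rewrite /cabs normcJ. Qed.

Lemma ReD z z' : complex.Re (z + z') = complex.Re z + complex.Re z'.
Proof. by case: z z' => [a b] [c d]. Qed.

Lemma Re_sum (I : Type) (s : seq I) (P : pred I) (F : I -> R[i]) :
  complex.Re (\sum_(i <- s | P i) F i) = \sum_(i <- s | P i) complex.Re (F i).
Proof.
elim/big_rec2: _ => // i x y _ <-; exact: ReD.
Qed.
End ComplexModulus.

Lemma ln_unbounded (R : realType) (B : R) : exists2 N, (0 < N)%N & B < ln N%:R.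
Proof.
exists (Num.truncn (expR B)).+1 => //.
by rewrite -{1}[B]expRK ltr_ln ?posrE ?expR_gt0 ?ltr0n // truncnS_gt.
Qed.

(** What matters is that the bound does not depend on [N]. *)
Lemma sum_ln_primes_le (R : realType) (h : nat -> R) L N :
  (forall n, 0 <= h n <= 1) -> (forall p, prime p -> (L < p)%N -> h p = 0) ->
  \sum_(1 <= p < N.+1 | prime p) ln p%:R * (h p / p%:R)
    <= \sum_(1 <= p < L.+1) ln p%:R.
Proof.
move=> h01 hL.
have le1 p : ln p%:R * (h p / p%:R) <= ln p%:R.
  rewrite ler_piMr ?ln_nat_ge0 //; have /andP[h0 h1] := h01 p.
  case: p h0 h1 => [|p] h0 h1; first by rewrite invr0 mulr0.
  by rewrite ler_pdivrMr // mul1r (le_trans h1) // ler1n.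
rewrite big_mkcond; apply: (@le_trans _ _ (\sum_(1 <= p < N.+1 | (p < L.+1)%N) ln p%:R)).
  rewrite [leRHS]big_mkcond; apply: ler_sum => p _; rewrite ltnS.
  case: ifPn => pp; case: leqP => // pL; rewrite ?ln_nat_ge0 //.
  by rewrite hL // mul0r mulr0.
have [le|lt] := leqP L.+1 N.+1.
  by rewrite -(big_nat_widen _ _ _ xpredT).
rewrite [leRHS](big_cat_nat _ (n := N.+1)) //=; last exact: ltnW.
rewrite big_mkcond -[leLHS]addr0 lerD ?sumr_ge0 //; last by move=> *; exact: ln_nat_ge0.
by apply: ler_sum => p _; case: ifP; rewrite ?ln_nat_ge0.
Qed.

(** * Logarithmic sums of one character *)

Section OneCharacter.
Variables (R : realType) (chi : nat -> R[i]) (M : R).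
Hypothesis chiM : forall a b, chi (a * b)%N = chi a * chi b.
Hypothesis chi1 : chi 1%N = 1.
Hypothesis chi_le1 : forall n, cabs (chi n) <= 1.
Hypothesis chi_bound : forall N, cabs (\sum_(0 <= k < N) chi k) <= M.

(** [Lsum] truncates [L(1, chi)], and [Tsum] truncates the series of [-L' / L] at 1. *)
Definition Lsum N := \sum_(1 <= e < N.+1) chi e * (e%:R^-1)%:C%C.

Definition Tsum N :=
  \sum_(1 <= n < N.+1) chi n * (mangoldt R n / n%:R)%:C%C.

Lemma M_ge0 : 0 <= M.
Proof. exact: le_trans (cabs_ge0 _) (chi_bound 0%N). Qed.

Lemma chi_abel (b : nat -> R) a N :
  (forall n, (a <= n)%N -> b n.+1 <= b n) ->
  (forall n, (a <= n)%N -> 0 <= b n) -> (a <= N)%N ->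
  cabs (\sum_(a <= n < N) chi n * (b n)%:C%C) <= 2 * M * b a.
Proof.
move=> b_dec b_ge0 aN; rewrite cabs_le !rmorphM rmorph_nat.
apply: (@abel_bound _ chi (fun n => (b n)%:C%C)) => //.
- by move=> n; rewrite -cabs_le.
- by move=> n an; rewrite lecR b_dec.
- by move=> n an; rewrite ler0c b_ge0.
Qed.

Lemma Lsum_tail a b : (a <= b)%N -> cabs (Lsum b - Lsum a) <= 2 * M / a.+1%:R.
Proof.
move=> ab; rewrite /Lsum (big_cat_nat _ (n := a.+1)) //= addrAC subrr add0r.
apply: (chi_abel (b := fun n => n%:R^-1)) => // n an.
have n0 : (0 < n)%N by exact: leq_trans an.
by rewrite lef_pV2 ?posrE ?ltr0n // ler_nat.
Qed.

(** [ln n / n] decreases once [ln n >= 1], so Abel summation starts at such an [n0]; the earlier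
    terms are bounded by absolute values. *)
Lemma log_Lsum_bounded : exists K, forall N,
  cabs (\sum_(1 <= n < N.+1) chi n * (ln n%:R / n%:R)%:C%C) <= K.
Proof.
have [n0 n00 ln1] := ln_unbounded (1 : R).
have term_ge0 n : 0 <= ln n%:R / n%:R :> R.
  by rewrite mulr_ge0 ?ln_nat_ge0 // invr_ge0.
have term n : cabs (chi n * (ln n%:R / n%:R)%:C%C) <= ln n%:R / n%:R.
  by rewrite cabsM cabsR ger0_norm // ler_piMl.
exists (\sum_(1 <= n < n0) ln n%:R / n%:R + 2 * M * (ln n0%:R / n0%:R)) => N.
have rest_ge0 : 0 <= 2 * M * (ln n0%:R / n0%:R).
  by rewrite mulr_ge0 // mulr_ge0 // M_ge0.
have [le|lt] := leqP n0 N.+1.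
  rewrite (big_cat_nat _ (n := n0)) //=; apply: (le_trans (cabsD _ _)).
  apply: lerD.
    by apply: (le_trans (cabs_sum _ _ _)); apply: ler_sum => n _.
  apply: (chi_abel (b := fun n => ln n%:R / n%:R)) => // n n0n.
  have n_gt0 : (0 < n)%N by exact: leq_trans n0n.
  have n_gt0' : 0 < n%:R :> R by rewrite ltr0n.
  have lnn : 1 <= ln n%:R :> R.
    by rewrite (le_trans (ltW ln1)) // ln_nat_le.
  rewrite ler_pdivrMr // mulrAC ler_pdivlMr // -natr1 mulrDr mulr1.
  have := lnS_le R n_gt0; rewrite -(ler_pM2r n_gt0') mulrDl mulVf ?gt_eqF //.
  by rewrite natr1 => h; lra.
apply: (le_trans (cabs_sum _ _ _)).
rewrite -[leLHS]addr0 lerD // [leRHS](big_cat_nat _ (n := N.+1)) //=; last exact: ltnW.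
by rewrite -[leLHS]addr0 lerD ?ler_sum ?sumr_ge0.
Qed.

Lemma cabs_Tsum_le N N' : (N <= N')%N ->
  cabs (Tsum N) <= \sum_(1 <= n < N'.+1) mangoldt R n / n%:R.
Proof.
move=> NN'; apply: (le_trans (cabs_sum _ _ _)).
have term_ge0 n : 0 <= mangoldt R n / n%:R by rewrite mulr_ge0 ?mangoldt_ge0 // invr_ge0.
rewrite [leRHS](big_cat_nat _ (n := N.+1)) //= -[leLHS]addr0 lerD ?sumr_ge0 //.
by apply: ler_sum => n _; rewrite cabsM cabsR ger0_norm // ler_piMl.
Qed.

Lemma inv_div_le N d : (0 < d <= N)%N ->
  (N %/ d).+1%:R^-1 <= d%:R / N%:R :> R.
Proof.
move=> /andP[d0 dN]; have N0 : (0 < N)%N by exact: leq_trans dN.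
rewrite ler_pdivlMr ?ltr0n // mulrC ler_pdivrMr ?ltr0n //.
by rewrite -natrM ler_nat mulnC ltnW // -ltn_divLR.
Qed.

Lemma log_Lsum_mangoldt N :
  \sum_(1 <= n < N.+1) chi n * (ln n%:R / n%:R)%:C%C =
  \sum_(1 <= d < N.+1) chi d * (mangoldt R d / d%:R)%:C%C * Lsum (N %/ d).
Proof.
under [RHS]eq_bigr do rewrite mulr_sumr.
rewrite -(sum_divisors N (fun d e =>
  chi d * (mangoldt R d / d%:R)%:C%C * (chi e * (e%:R^-1)%:C%C))).
rewrite big_nat_cond [RHS]big_nat_cond; apply: eq_bigr => n /andP[/andP[n0 nN] _].
rewrite (@ln_mangoldt _ N) ?n0 // mulr_suml rmorph_sum mulr_sumr.
apply: eq_bigr => d dn; rewrite mulrACA -chiM mulnC divnK // -rmorphM.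
congr (_ * _%:C%C); by rewrite -[RHS]mulrA -invfM -natrM [(d * _)%N]mulnC divnK.
Qed.

(** In [log_Lsum_mangoldt], replace [Lsum (N %/ d)] by [Lsum N]. The tail bound makes the total
    error at most [2 M psi(N) / N <= 8 M], so [Lsum N * Tsum N] is bounded, and one divides by
    [c]. *)
Lemma Tsum_bounded (c : R) N0 : 0 < c -> (forall N, (N0 <= N)%N -> c <= cabs (Lsum N)) ->
  exists K, forall N, cabs (Tsum N) <= K.
Proof.
move=> c0 Lc; have [K HK] := log_Lsum_bounded; have M0 := M_ge0.
have K0 : 0 <= K by exact: le_trans (cabs_ge0 _) (HK 0%N).
exists ((K + 8 * M) / c + \sum_(1 <= n < N0.+1) mangoldt R n / n%:R) => N.
have sum_ge0 : 0 <= \sum_(1 <= n < N0.+1) mangoldt R n / n%:R.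
  by apply: sumr_ge0 => n _; rewrite mulr_ge0 ?mangoldt_ge0 // invr_ge0.
have [NN0|N0N] := leqP N N0.
  rewrite (le_trans (cabs_Tsum_le NN0)) // lerDr divr_ge0 ?(ltW c0) //; lra.
rewrite -[leLHS]addr0 lerD // ler_pdivlMr // mulrC.
apply: (@le_trans _ _ (cabs (Lsum N) * cabs (Tsum N))).
  by rewrite ler_wpM2r ?cabs_ge0 // Lc // ltnW.
rewrite -cabsM; have N_gt0 : (0 < N)%N by exact: leq_ltn_trans N0N.
have N_gt0' : 0 < N%:R :> R by rewrite ltr0n.
have -> : Lsum N * Tsum N = \sum_(1 <= n < N.+1) chi n * (ln n%:R / n%:R)%:C%C -
    \sum_(1 <= d < N.+1) chi d * (mangoldt R d / d%:R)%:C%C * (Lsum (N %/ d) - Lsum N).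
  rewrite log_Lsum_mangoldt -sumrB mulr_sumr; apply: eq_bigr => d _.
  by rewrite -mulrBr opprB addrC subrK mulrC.
apply: (le_trans (cabsB _ _)); apply: lerD => //.
apply: (le_trans (cabs_sum _ _ _)).
apply: (@le_trans _ _ (\sum_(1 <= d < N.+1) 2 * M / N%:R * mangoldt R d)).
  apply: ler_sum_nat => d /andP[d0 dN].
  have Ld : cabs (Lsum (N %/ d) - Lsum N) <= 2 * M * (d%:R / N%:R).
    have -> : cabs (Lsum (N %/ d) - Lsum N) = cabs (Lsum N - Lsum (N %/ d)).
      by rewrite /cabs distrC.
    apply: (le_trans (Lsum_tail (leq_div N d))).
    by rewrite ler_wpM2l ?inv_div_le ?d0 //; lra.
  rewrite !cabsM cabsR ger0_norm; last first.
    by rewrite mulr_ge0 ?mangoldt_ge0 // invr_ge0.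
  have -> : 2 * M / N%:R * mangoldt R d =
      1 * (mangoldt R d / d%:R) * (2 * M * (d%:R / N%:R)).
    by field; rewrite !gt_eqF // ltr0n.
  rewrite ler_pM ?mulr_ge0 ?cabs_ge0 ?invr_ge0 ?mangoldt_ge0 //.
  by rewrite ler_wpM2r // mulr_ge0 ?invr_ge0 ?mangoldt_ge0.
rewrite -mulr_sumr -/(psi R N).
apply: (@le_trans _ _ (2 * M / N%:R * (4 * N%:R))).
  by rewrite ler_wpM2l ?psi_le_linear // mulr_ge0 ?invr_ge0 //; lra.
by rewrite le_eqVlt; apply/orP; left; apply/eqP; field; rewrite gt_eqF.
Qed.

(** Moebius inversion gives [ln N] at [n = 1], plus [mangoldt n], as the sum of
    [moebius d * ln (N / d)] over [d] dividing [n]. Twisting by [chi] brings out [Lsum (N %/ d)], of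
    size at most [2 M d / N], and the sum of [ln (N / d)] is at most [N]. *)
Lemma Tsum_vanishing N : (0 < N)%N ->
  (forall y, cabs (Lsum y) <= 2 * M / y.+1%:R) ->
  cabs ((ln N%:R)%:C%C + Tsum N) <= 2 * M.
Proof.
move=> N0 van; have M0 := M_ge0; have N0' : 0 < N%:R :> R by rewrite ltr0n.
have -> : (ln N%:R)%:C%C + Tsum N = \sum_(1 <= d < N.+1)
    chi d * (moebius R N d * (ln N%:R - ln d%:R) / d%:R)%:C%C * Lsum (N %/ d).
  under [RHS]eq_bigr do rewrite mulr_sumr.
  rewrite -(sum_divisors N (fun d e => chi d *
    (moebius R N d * (ln N%:R - ln d%:R) / d%:R)%:C%C * (chi e * (e%:R^-1)%:C%C))).
  have -> : (ln N%:R)%:C%C = \sum_(1 <= n < N.+1)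
      chi n * ((ln N%:R * (n == 1)%:R) / n%:R)%:C%C :> R[i].
    rewrite big_ltn // big1_seq ?addr0 => [|n]; last first.
      rewrite mem_index_iota => /andP[_ /andP[n2 _]].
      by rewrite gtn_eqF // mulr0 mul0r rmorph0 mulr0.
    by rewrite chi1 eqxx mulr1 divr1 mul1r.
  rewrite /Tsum -big_split /= big_nat_cond [RHS]big_nat_cond.
  apply: eq_bigr => n /andP[/andP[n0 nN] _].
  rewrite -mulrDr -rmorphD -mulrDl /=.
  have n0N : (0 < n <= N)%N by rewrite n0.
  have -> : ln N%:R * (n == 1)%:R + mangoldt R n =
      \sum_(1 <= d < N.+1 | (d %| n)%N) moebius R N d * (ln N%:R - ln d%:R).
    have lnn : (n == 1)%:R * ln n%:R = 0 :> R.
      by case: eqP => [->|_]; rewrite ?ln1 ?mulr0 ?mul0r.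
    rewrite -(moebius_ln R n0N) -[LHS]subr0 -[X in _ - X]lnn -(sum_moebius R n0N).
    rewrite mulr_sumr mulr_suml -big_split -sumrB /= big_nat_cond [RHS]big_nat_cond.
    apply: eq_bigr => d /andP[/andP[d0 _] dn].
    have -> : ln n%:R = ln (n %/ d)%:R + ln d%:R :> R.
      by rewrite -lnM_nat ?divnK // divn_gt0 // dvdn_leq.
    by ring.
  rewrite mulr_suml rmorph_sum mulr_sumr.
  apply: eq_bigr => d dn; rewrite mulrACA -chiM mulnC divnK // -rmorphM.
  congr (_ * _%:C%C); by rewrite -[RHS]mulrA -invfM -natrM [(d * _)%N]mulnC divnK.
apply: (le_trans (cabs_sum _ _ _)).
apply: (@le_trans _ _ (\sum_(1 <= d < N.+1) 2 * M / N%:R * (ln N%:R - ln d%:R))).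
  apply: ler_sum_nat => d /andP[d0 dN].
  have ln0 : 0 <= ln N%:R - ln d%:R :> R by rewrite subr_ge0 ln_nat_le.
  have Ld : cabs (Lsum (N %/ d)) <= 2 * M * (d%:R / N%:R).
    apply: (le_trans (van _)).
    by rewrite ler_wpM2l ?inv_div_le ?d0 //; lra.
  have -> : 2 * M / N%:R * (ln N%:R - ln d%:R) =
      1 * (1 * (ln N%:R - ln d%:R) / d%:R) * (2 * M * (d%:R / N%:R)).
    by field; rewrite !gt_eqF // ltr0n.
  rewrite !cabsM cabsR ler_pM ?mulr_ge0 ?cabs_ge0 //.
  rewrite ler_pM ?cabs_ge0 // normrM [`|_ * _|]normrM [`|d%:R^-1|]ger0_norm ?invr_ge0 //.
  rewrite ler_wpM2r ?invr_ge0 // [`|_ - _|]ger0_norm // ler_wpM2r //.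
  exact: moebius_norm.
rewrite -mulr_sumr sumrB sumr_const_nat subn1 /= -[ln N%:R *+ N]mulr_natl.
apply: (@le_trans _ _ (2 * M / N%:R * N%:R)).
  rewrite ler_wpM2l ?mulr_ge0 ?invr_ge0 //.
  by have := sum_ln_ge R N; lra.
by rewrite divfK // gt_eqF.
Qed.

(** The first alternative expresses [L(1, chi) = 0] without limits. If it fails at [y], the tail
    bound keeps all later partial sums above the positive excess at [y]. *)
Lemma Tsum_dichotomy :
  (forall y, cabs (Lsum y) <= 2 * M / y.+1%:R) \/
  exists K, forall N, cabs (Tsum N) <= K.
Proof.
have [?|/existsNP[y /negP]] := pselect (forall y, cabs (Lsum y) <= 2 * M / y.+1%:R).
  by left.
rewrite -ltNge => Ly; right.
apply: (@Tsum_bounded (cabs (Lsum y) - 2 * M / y.+1%:R) y); first by rewrite subr_gt0.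
move=> N yN; rewrite lerBlDr.
apply: (@le_trans _ _ (cabs (Lsum N) + cabs (Lsum N - Lsum y))).
  by rewrite -{1}[Lsum y](subKr (Lsum N)) cabsB.
by rewrite lerD2l Lsum_tail.
Qed.
End OneCharacter.

Lemma complex_sum_nat_mangoldt (R : realType) N (h : nat -> R) :
  \sum_(1 <= n < N.+1) (h n)%:C%C * (mangoldt R n / n%:R)%:C%C =
  (\sum_(1 <= n < N.+1) mangoldt R n * (h n / n%:R))%:C%C.
Proof.
rewrite rmorph_sum; apply: eq_bigr => n _ /=.
by rewrite -rmorphM; congr _%:C%C; ring.
Qed.

(** The loss 3 is 1 from [mertens_lower] and 2 from higher prime powers; the remaining sum covers
    the primes dividing [m], all at most [m]. *)
Lemma Tsum_trivial_ge (R : realType) m N (chi : nat -> R[i]) : (0 < m)%N ->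
  (forall n, chi n = (coprime m n)%:R) -> (0 < N)%N ->
  ln N%:R - (3 + \sum_(1 <= p < m.+1) ln p%:R) <= complex.Re (Tsum chi N).
Proof.
move=> m0 chiE N0.
have -> : complex.Re (Tsum chi N) =
    \sum_(1 <= n < N.+1) mangoldt R n / n%:R -
    \sum_(1 <= n < N.+1) mangoldt R n * ((~~ coprime m n)%:R / n%:R).
  rewrite /Tsum; under eq_bigr do rewrite chiE -(rmorph_nat (real_complex R)).
  rewrite complex_sum_nat_mangoldt /= -sumrB; apply: eq_bigr => n _.
  by case: coprime => /=; ring.
have h01 n : 0 <= ((~~ coprime m n)%:R : R) <= 1 by rewrite ler0n lern1 leq_b1.
have hL p : prime p -> (m < p)%N -> (~~ coprime m p)%:R = 0 :> R.
  by move=> pp mp; rewrite coprime_sym prime_coprime // negbK gtnNdvd.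
have := mertens_lower R N0; have := sum_mangoldt_le_primes N h01.
have := sum_ln_primes_le N h01 hL; lra.
Qed.

Lemma Tsum_trivial_le (R : realType) m N (chi : nat -> R[i]) : (0 < N)%N ->
  (forall n, chi n = (coprime m n)%:R) ->
  complex.Re (Tsum chi N) <= ln N%:R + 4.
Proof.
move=> N0 chiE; apply: le_trans (mertens_upper R N0).
apply: (le_trans (Re_le_cabs _)); apply: cabs_Tsum_le => // n.
by rewrite chiE cabs_le normr_nat lern1 leq_b1.
Qed.

Lemma Lsum_conj (R : realType) (chi chi' : nat -> R[i]) N :
  (forall n, chi' n = (chi n)^*%C) -> Lsum chi' N = (Lsum chi N)^*%C.
Proof.
move=> chiE; rewrite /Lsum rmorph_sum; apply: eq_bigr => n _ /=.
by rewrite rmorphM chiE; congr (_ * _); exact/esym/conjc_real.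
Qed.

Theorem dirichlet_primes (R : realType) m a L : (1 < m)%N -> coprime m a ->
  exists p, [/\ prime p, (L < p)%N & p = a %[mod m]].
Proof.
move=> m1 am; have m0 : (0 < m)%N by exact: ltnW.
have [I [i0 [inv [chi [[chiM chi1 chi_norm chi_i0] chi_bound
  [invK inv_i0 chi_inv chi_real] [chi_sum chi_suma]]]]]] := dirichlet_characters R m1.
have chi_le1 i n : cabs (chi i n) <= 1.
  by rewrite cabs_le chi_norm lern1 leq_b1.
have chi_bd i : i != i0 -> forall N, cabs (\sum_(0 <= k < N) chi i k) <= m%:R.
  by move=> ii0 N; rewrite cabs_le rmorph_nat chi_bound.
pose vanish i := forall y, cabs (Lsum (chi i) y) <= 2 * m%:R / y.+1%:R :> R.
pose bounded i := exists K : R, forall N, cabs (Tsum (chi i) N) <= K.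
have dich i : i != i0 -> vanish i \/ bounded i.
  by move=> ii0; apply: Tsum_dichotomy => //; exact: chi_bd.
have vanishT i N : i != i0 -> vanish i -> (0 < N)%N ->
    complex.Re (Tsum (chi i) N) <= 2 * m%:R - ln N%:R.
  move=> ii0 van N0.
  have h := Tsum_vanishing (chiM i) (chi1 i) (chi_le1 i) (chi_bd i ii0) N0 van.
  have := le_trans (Re_le_cabs _) h; rewrite ReD /=; lra.
have sumT N b : \sum_i chi i b * Tsum (chi i) N =
    \sum_(1 <= n < N.+1) (\sum_i chi i (b * n)%N) * (mangoldt R n / n%:R)%:C%C.
  rewrite /Tsum; under eq_bigr do rewrite mulr_sumr.
  rewrite exchange_big; apply: eq_bigr => n _; rewrite [RHS]mulr_suml.
  by apply: eq_bigr => i _; rewrite chiM mulrA.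
have nonvanish i : i != i0 -> ~ vanish i.
  move=> ii0 van; have [ij|ij] := eqVneq (inv i) i.
    have chi_i n : chi i n = (complex.Re (chi i n))%:C%C.
      by have [] := chi_real i n ij => ->; rewrite ?rmorphN.
    apply: (@real_character_nonvanishing R (fun n => complex.Re (chi i n))
      _ _ _ m%:R (2 * m%:R)).
    - by rewrite chi1.
    - by move=> u v; rewrite chiM {1}(chi_i u) {1}(chi_i v) -rmorphM.
    - move=> n; have [] := chi_real i n ij => ->; rewrite ?raddfN /=;
        by [constructor 1|constructor 2|constructor 3].
    - move=> n; rewrite -cabsR rmorph_sum /=.
      by under eq_bigr do rewrite -chi_i; exact: chi_bd.
    - move=> n n0; rewrite -cabsR rmorph_sum /=.
      under eq_bigr do rewrite rmorphM /= -chi_i.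
      apply: le_trans (van n) _.
      rewrite ler_wpM2l ?mulr_ge0 // lef_pV2 ?posrE ?ltr0n // ler_nat //.
  (* The conjugate is a second vanishing character. The two contribute at most [4 m - 2 ln N],
     against [ln N + 4] from the trivial character and a bounded rest, so the nonnegative total
     would become negative. *)
  have j0 : inv i != i0 by apply: contra ii0 => /eqP h; rewrite -(invK i) h inv_i0.
  have vanj : vanish (inv i).
    by move=> y; rewrite (Lsum_conj _ (chi_inv i)) cabs_conj; exact: van.
  have /choice[B HB] : forall k, exists B : R, forall N, (0 < N)%N -> k != i0 ->
      complex.Re (Tsum (chi k) N) <= B.
    move=> k; have [->|ki0] := eqVneq k i0; first by exists 0.
    have [vank|[K HK]] := dich k ki0.
      exists (2 * m%:R) => N N0 _; have := vanishT k N ki0 vank N0.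
      by have := ln_nat_ge0 R N; lra.
    by exists K => N _ _; apply: le_trans (Re_le_cabs _) (HK N).
  pose B' := \sum_(k | [&& k != i0, k != i & k != inv i]) B k.
  have [N N0 lnN] := ln_unbounded (4 + 4 * m%:R + B' : R).
  have : 0 <= complex.Re (\sum_k Tsum (chi k) N).
    have -> : \sum_k Tsum (chi k) N = \sum_k chi k 1%N * Tsum (chi k) N.
      by apply: eq_bigr => k _; rewrite chi1 mul1r.
    rewrite sumT; under eq_bigr do rewrite mul1n chi_sum -(rmorph_nat (real_complex R)).
    rewrite complex_sum_nat_mangoldt /=; apply: sumr_ge0 => n _.
    by rewrite !mulr_ge0 ?mangoldt_ge0 ?invr_ge0.
  rewrite Re_sum (bigD1 i0) //= (bigD1 i) //= (bigD1 (inv i)) /=; last by rewrite j0.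
  have -> : \sum_(k | (k != i0) && (k != i) && (k != inv i)) complex.Re (Tsum (chi k) N) =
      \sum_(k | [&& k != i0, k != i & k != inv i]) complex.Re (Tsum (chi k) N).
    by apply: eq_bigl => k; rewrite andbA.
  have : \sum_(k | [&& k != i0, k != i & k != inv i]) complex.Re (Tsum (chi k) N) <= B'.
    by apply: ler_sum => k /andP[ki0 _]; exact: HB.
  have := Tsum_trivial_le N0 chi_i0; have := vanishT i N ii0 van N0.
  have := vanishT _ N j0 vanj N0; lra.
have /choice[B HB] : forall k, exists B : R, forall N, k != i0 ->
    cabs (Tsum (chi k) N) <= B.
  move=> k; have [->|ki0] := eqVneq k i0; first by exists 0.
  have [/(nonvanish _ ki0)|[K HK]] // := dich k ki0.
  by exists K => N _.
have [b bm chi_b] := chi_suma a am.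
(* Without such a prime, only primes up to [L] and higher prime powers contribute to the class of
   [a], so its sum is bounded in [N]. The trivial character nevertheless forces growth like [ln N],
   all other characters being bounded. *)
apply: contrapT => no_prime.
pose h n : R := (n == a %[mod m])%:R.
have h01 n : 0 <= h n <= 1 by rewrite ler0n lern1 leq_b1.
have hL p : prime p -> (L < p)%N -> h p = 0.
  move=> pp Lp; rewrite /h; case: eqP => // pa.
  by case: no_prime; exists p.
pose B' := \sum_(k | k != i0) B k.
pose c := #|I|%:R * (2 + \sum_(1 <= p < L.+1) ln p%:R) : R.
have [N N0 lnN] := ln_unbounded (3 + \sum_(1 <= p < m.+1) ln p%:R + B' + c : R).
have upper : complex.Re (\sum_i chi i b * Tsum (chi i) N) <= c.
  rewrite sumT; under eq_bigr do rewrite chi_b -(rmorph_nat (real_complex R)) natrM.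
  rewrite complex_sum_nat_mangoldt /=.
  under eq_bigr do rewrite -mulrA mulrCA.
  rewrite -mulr_sumr ler_wpM2l //.
  have := sum_mangoldt_le_primes N h01; have := sum_ln_primes_le N h01 hL.
  by rewrite /h; lra.
move: upper; rewrite (bigD1 i0) //= ReD chi_i0 bm mul1r.
have : - B' <= complex.Re (\sum_(k | k != i0) chi k b * Tsum (chi k) N).
  rewrite Re_sum -sumrN; apply: ler_sum => k ki0.
  apply: le_trans (Re_ge_cabs _); rewrite lerN2 cabsM.
  apply: le_trans (HB k N ki0); rewrite ler_piMl ?cabs_ge0 //.
have := Tsum_trivial_ge m0 chi_i0 N0.
lra.
Qed.

(** * Countable spaces with clopen bases *)

Import numFieldNormedType.Exports.
Local Open Scope classical_set_scope.

Lemma bounded_mono_stable (r : nat -> nat) B :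
  (forall n, (r n <= r n.+1)%N) -> (forall n, (r n <= B)%N) ->
  exists N, forall n, (N <= n)%N -> r n = r N.
Proof.
move=> r_mono rB; have r_le m n : (m <= n)%N -> (r m <= r n)%N.
  by apply: (homo_leq (@leqnn) leq_trans).
have [M [N rN] Mmax] : exists2 M, exists N, r N = M & forall n, (r n <= M)%N.
  have ex : exists M, `[< exists N, r N = M >].
    by exists (r 0%N); apply/asboolP; exists 0%N.
  have ub M : `[< exists N, r N = M >] -> (M <= B)%N by move=> /asboolP[N <-].
  case: (ex_maxnP ex ub) => M /asboolP MP Mmax.
  by exists M => // n; apply: Mmax; apply/asboolP; exists n.
exists N => n Nn; apply/eqP; rewrite eqn_leq (r_le N n) // andbT rN.
exact: Mmax.
Qed.

(** Says that [c] is a homeomorphism onto the finitely supported points of the Cantor space, a model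
    that does not depend on [T]. *)
Definition finite_bit_coding (T : topologicalType) (c : T -> nat -> bool) :=
  [/\ injective c,
      forall x, exists N, forall n, (N <= n)%N -> c x n = false,
      forall s N, (forall n, (N <= n)%N -> s n = false) -> exists x, c x = s &
      forall x A, nbhs x A <->
        exists n, [set y | forall i, (i < n)%N -> c y i = c x i] `<=` A].

Lemma homeomorphic_of_codings (T U : topologicalType)
    (c : T -> nat -> bool) (d : U -> nat -> bool) :
  finite_bit_coding c -> finite_bit_coding d -> homeomorphic T U.
Proof.
move=> [c_inj c_fin c_surj c_nbhs] [d_inj d_fin d_surj d_nbhs].
have /choice[f fE] : forall x, exists y, d y = c x.
  by move=> x; have [N HN] := c_fin x; exact: d_surj HN.
have /choice[g gE] : forall y, exists x, c x = d y.
  by move=> y; have [N HN] := d_fin y; exact: c_surj HN.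
exists f, g; split.
- by move=> x; apply: c_inj; rewrite gE fE.
- by move=> y; apply: d_inj; rewrite fE gE.
- move=> x A /d_nbhs[n nA]; apply/c_nbhs; exists n => x' /= x'n.
  by apply: nA => i; rewrite /= !fE; exact: x'n.
- move=> y A /c_nbhs[n nA]; apply/d_nbhs; exists n => y' /= y'n.
  by apply: nA => i; rewrite /= !gE; exact: y'n.
Qed.

(** * The tree of clopen splittings *)

Section Coding.
Variables (T : topologicalType) (x0 : T) (rank : T -> nat).
Variable W0 : T -> nat -> set T.
Hypothesis rank_inj : injective rank.
Hypothesis W0_clopen : forall x n, clopen (W0 x n).
Hypothesis W0_mem : forall x n, W0 x n x.
Hypothesis W0_base : forall (x : T) (A : set T), nbhs x A -> exists n, W0 x n `<=` A.
Hypothesis separated_points : forall x y : T, x <> y ->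
  exists2 A : set T, nbhs x A & ~ A y.
Hypothesis crowded : forall (x : T) (A : set T), nbhs x A -> exists2 y, y <> x & A y.

(** Intersecting makes the base at [x] decreasing, so a larger index is always a finer
    neighbourhood. *)
Fixpoint shrinking x n : set T :=
  if n is n'.+1 then shrinking x n' `&` W0 x n else W0 x 0%N.

Lemma shrinking_clopen x n : clopen (shrinking x n).
Proof. by elim: n => [|n IHn] //=; exact: clopenI. Qed.

Lemma shrinking_mem x n : shrinking x n x.
Proof. by elim: n => [|n IHn] //=; split. Qed.

Lemma shrinking_le x m n : (m <= n)%N -> shrinking x n `<=` shrinking x m.
Proof.
move=> /subnKC <-; elim: (n - m)%N => [|k IHk]; first by rewrite addn0.
by rewrite addnS /= => y [/IHk].
Qed.

Lemma shrinking_base x A : nbhs x A -> exists n, shrinking x n `<=` A.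
Proof.
move=> /W0_base[n nA]; exists n => y; case: n nA => [|n] nA /=; first exact: nA.
by move=> [_ /nA].
Qed.

Lemma shrinking_sep x y : x <> y -> exists n, ~ shrinking x n y.
Proof.
by move=> /separated_points[A /shrinking_base[n nA] Ay]; exists n => /nA.
Qed.

Definition first_point (U : set T) : T :=
  xget x0 [set x | U x /\ forall y, U y -> (rank x <= rank y)%N].

Definition second_point (U : set T) : T := first_point (U `\ first_point U).

Definition sep_index x y : nat := xget 0%N [set n | ~ shrinking x n y].

(* The index is large enough to leave the second point of [U] in the right part. *)
Definition left_part n (U : set T) : set T :=
  U `&` shrinking (first_point U) (maxn n (sep_index (first_point U) (second_point U))).

Definition right_part n (U : set T) : set T := U `\` left_part n U.

Lemma first_pointP U : U !=set0 ->
  U (first_point U) /\ forall y, U y -> (rank (first_point U) <= rank y)%N.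
Proof.
move=> [x Ux]; rewrite /first_point; case: xgetP => [? -> []//|/(_ _) none].
exfalso.
have ex : exists n, `[< exists2 y, U y & rank y = n >].
  by exists (rank x); apply/asboolP; exists x.
case: (ex_minnP ex) => n /asboolP[y Uy yn] nmin.
by apply: (none y); split=> // z Uz; rewrite yn nmin //; apply/asboolP; exists z.
Qed.

Lemma first_point_uniq U x : U x -> (forall y, U y -> (rank x <= rank y)%N) ->
  first_point U = x.
Proof.
move=> Ux xmin; have [|Uf fmin] := @first_pointP U; first by exists x.
by apply: rank_inj; apply/eqP; rewrite eqn_leq fmin // xmin.
Qed.

Lemma second_pointP U : U !=set0 -> open U ->
  U (second_point U) /\ second_point U <> first_point U.
Proof.
move=> U0 Uo; have [Uf fmin] := first_pointP U0.
have [|y yf Uy] := @crowded (first_point U) U; first exact: open_nbhs_nbhs.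
by have [|[]] := @first_pointP (U `\ first_point U); first by exists y.
Qed.

Lemma left_part_first n U : U !=set0 -> left_part n U (first_point U).
Proof. by move=> /first_pointP[Uf _]; split=> //; exact: shrinking_mem. Qed.

Lemma left_part_second n U : U !=set0 -> open U -> ~ left_part n U (second_point U).
Proof.
move=> U0 Uo [_]; have [Us sf] := second_pointP U0 Uo.
move=> /(shrinking_le (leq_maxr _ _)); rewrite /sep_index.
case: xgetP => [k -> //|none].
have [|k] := @shrinking_sep (first_point U) (second_point U).
  by move=> fs; apply: sf.
by move=> /none.
Qed.

Lemma first_point_left n U : U !=set0 -> first_point (left_part n U) = first_point U.
Proof.
move=> U0; apply: first_point_uniq; first exact: left_part_first.
by move=> y [Uy _]; have [_] := first_pointP U0; apply.
Qed.

Definition good (U : set T) := U !=set0 /\ clopen U.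

Lemma left_part_good n U : good U -> good (left_part n U).
Proof.
move=> [U0 Uc]; split; first by exists (first_point U); exact: left_part_first.
by apply: clopenI => //; exact: shrinking_clopen.
Qed.

Lemma right_part_good n U : good U -> good (right_part n U).
Proof.
move=> [U0 Uc]; split.
  exists (second_point U); split; last by apply: left_part_second => //; case: Uc.
  by have [] := second_pointP U0 Uc.1.
apply: clopenI => //; apply: (@clopenC _ _ set0).
by apply: clopenI => //; exact: shrinking_clopen.
Qed.

Fixpoint node (s : nat -> bool) n : set T :=
  if n is n'.+1 then (if s n' then right_part else left_part) n' (node s n')
  else setT.

(** The branch followed by the point [x], each turn being decided by membership; [code] reads its
    bits off this branch, and [path_nodeE] identifies it with the [node] they describe. *)
Fixpoint path_node (x : T) n : set T :=
  if n is n'.+1 then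
    (if `[< left_part n' (path_node x n') x >] then left_part else right_part)
      n' (path_node x n')
  else setT.

Definition code x n : bool := ~~ `[< left_part n (path_node x n) x >].

Lemma path_nodeE x n : path_node x n = node (code x) n.
Proof.
elim: n => //= n IHn; rewrite -IHn /code.
by case: asboolP.
Qed.

Lemma path_node_mem x n : path_node x n x.
Proof. by elim: n => //= n IHn; case: asboolP. Qed.

Lemma node_good s n : good (node s n).
Proof.
elim: n => [|n IHn] /=; first by split; [exists x0|exact: clopenT].
by case: (s n); [exact: right_part_good|exact: left_part_good].
Qed.

Lemma node_le s m n : (m <= n)%N -> node s n `<=` node s m.
Proof.
move=> /subnKC <-; elim: (n - m)%N => [|k IHk]; first by rewrite addn0.
by rewrite addnS /= => y; case: (s _) => -[/IHk].
Qed.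

Lemma eq_node s s' n : (forall i, (i < n)%N -> s i = s' i) -> node s n = node s' n.
Proof.
elim: n => //= n IHn ss'; rewrite ss' // IHn // => i iN.
by apply: ss'; rewrite ltnS ltnW.
Qed.

Lemma nodeP s x n : node s n x <-> forall i, (i < n)%N -> code x i = s i.
Proof.
split; last by move=> /eq_node <-; rewrite -path_nodeE; exact: path_node_mem.
elim: n => // n IHn xn; have /IHn xs : node s n x by apply: node_le xn.
move=> i; rewrite ltnS leq_eqVlt => /orP[/eqP ->|]; last exact: xs.
move: xn; rewrite /= /code path_nodeE (eq_node xs).
by case: (s n) => [[_ ?]|?]; [apply/negP => /asboolP|apply/negbF/asboolP].
Qed.

(** Along the branch of [x] the rank of the first point is nondecreasing and at most [rank x], hence
    eventually constant. A right turn discards the first point, so all later bits are 0; the nodes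
    then shrink around the first point and would exclude [x] if it were different. *)
Lemma first_point_eventually x : exists N, forall n, (N <= n)%N ->
  code x n = false /\ first_point (node (code x) n) = x.
Proof.
pose U := node (code x); pose r n := rank (first_point (U n)).
have Ug n : good (U n) by exact: node_good.
have Ux n : U n x by rewrite /U -path_nodeE; exact: path_node_mem.
have rS n : (r n <= r n.+1)%N.
  have [_] := first_pointP (Ug n).1; apply.
  by apply: (node_le (leqnSn n)); have [] := first_pointP (Ug n.+1).1.
have rx n : (r n <= rank x)%N by have [_] := first_pointP (Ug n).1; apply.
have [N rN] := bounded_mono_stable rS rx.
have first_const n : (N <= n)%N -> first_point (U n) = first_point (U N).
  by move=> Nn; apply: rank_inj; exact: rN.
have code0 n : (N <= n)%N -> code x n = false.
  move=> Nn; apply/negbTE/negP => xn.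
  have : U n.+1 (first_point (U n)).
    rewrite first_const // -(first_const n.+1) ?(leq_trans Nn) //.
    by have [] := first_pointP (Ug n.+1).1.
  by rewrite /U /= xn => -[_]; apply; apply: left_part_first; case: (Ug n).
suff zx : first_point (U N) = x.
  by exists N => n Nn; rewrite code0 // -/(U n) first_const.
apply: contrapT => /shrinking_sep[k]; apply.
pose n := maxn N k; have Nn : (N <= n)%N by exact: leq_maxl.
have := Ux n.+1; rewrite /U /= code0 // => -[_].
rewrite -/(U n) first_const //; apply: shrinking_le.
by rewrite (leq_trans _ (leq_maxl _ _)) // leq_maxr.
Qed.

Lemma code_finite_bit_coding : finite_bit_coding code.
Proof.
split.
- move=> x y xy; have [N HN] := first_point_eventually x.
  have [N' HN'] := first_point_eventually y.
  have [_ <-] := HN (maxn N N') (leq_maxl _ _).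
  by have [_ <-] := HN' (maxn N N') (leq_maxr _ _); rewrite xy.
- by move=> x; have [N HN] := first_point_eventually x; exists N => n /HN[].
(* Beyond [N] the sequence turns only left, and left parts keep the first point, so that point
   follows all of [s]. *)
- move=> s N sN; exists (first_point (node s N)).
  have first_const k : first_point (node s (N + k)%N) = first_point (node s N).
    elim: k => [|k IHk]; first by rewrite addn0.
    rewrite addnS /= sN ?leq_addr // first_point_left //.
    by have [] := node_good s (N + k)%N.
  apply/funext => n; apply: (nodeP s _ n.+1).1 => //.
  have [nN|Nn] := leqP n.+1 N.
    by apply: node_le nN _ _; have [] := first_pointP (node_good s N).1.
  rewrite -(subnKC (ltnW Nn)) -(first_const (n.+1 - N)%N).
  by have [] := first_pointP (node_good s (N + (n.+1 - N))).1.
- move=> x A; split=> [/shrinking_base[k kA]|[n nA]].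
    (* From [N] on the first point is [x] and the bit is 0, so the node at [n + 1] lies in
       [shrinking x n], inside [A]. *)
    have [N HN] := first_point_eventually x.
    pose n := maxn N k; exists n.+1 => y /= /nodeP; rewrite /=.
    have [-> zx] := HN n (leq_maxl _ _).
    move=> [_]; rewrite zx => yk; apply: kA; apply: shrinking_le yk.
    by rewrite (leq_trans _ (leq_maxl _ _)) // leq_maxr.
  have -> : A = A `|` node (code x) n.
    by apply/esym/setUidPl => y /nodeP; exact: nA.
  apply: filterS (@subsetUr _ _ _) _; apply: open_nbhs_nbhs; split.
    by case: (node_good (code x) n) => _ [].
  by rewrite -path_nodeE; exact: path_node_mem.
Qed.
End Coding.

(** * Coding of the rationals *)

Lemma sqr_rat_neq2 (q : rat) : q ^+ 2 != 2.
Proof.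
apply/eqP => q2; have d0 : (0 < `|denq q|)%N by rewrite absz_gt0 denq_neq0.
have : (numq q ^+ 2 = 2 * denq q ^+ 2)%R.
  apply: (@intr_inj rat); rewrite [RHS]intrM !rmorphXn /=.
  by rewrite numqE exprMn q2.
move=> /(congr1 absz); rewrite abszX abszM abszX /= => nd.
have n0 : (0 < `|numq q|)%N.
  by rewrite lt0n; apply: contraTneq d0 => n0; move: nd; rewrite n0; case: `|denq q|%N.
(* The 2-adic valuation is even on the left and odd on the right. *)
have := congr1 (logn 2) nd; rewrite lognM ?expn_gt0 ?d0 // !lognX.
by rewrite (_ : logn 2 2 = 1%N) // => /(congr1 odd); rewrite oddD !oddM.
Qed.

(** The basic neighbourhoods are balls of radius [sqrt 2 / (n + 1)]: as 2 is not a rational square,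
    the strict and weak inequalities define the same set, which is therefore clopen. *)
Lemma rat_finite_bit_coding : exists c, @finite_bit_coding rat^o c.
Proof.
pose W (x : rat^o) n : set rat^o := [set y | ((y - x) * n.+1%:R) ^+ 2 < 2].
have W_cts x n : continuous (fun y : rat^o => ((y - x) * n.+1%:R) ^+ 2 : rat^o).
  move=> y.
  have h : ((z - x) * n.+1%:R : rat^o) @[z --> y] --> ((y - x) * n.+1%:R : rat^o).
    by apply: cvgM; [apply: cvgB; [exact: cvg_id|exact: cvg_cst]|exact: cvg_cst].
  exact: (cvgM h h).
have W_base x A : nbhs x A -> exists n, W x n `<=` A.
  move=> /nbhs_ballP[e /= e0 eA]; exists (Num.truncn (2 / e)) => y /= Wy.
  apply: eA; rewrite /ball /= distrC; set n := Num.truncn _ in Wy.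
  have ne : 2 / e < n.+1%:R by exact: truncnS_gt.
  rewrite ltr_pdivrMr // in ne; rewrite ltNge; apply/negP => ey.
  have : 2 < `|(y - x) * n.+1%:R|.
    rewrite normrM [`|n.+1%:R|]ger0_norm // (lt_le_trans ne) // mulrC ler_wpM2r //.
  have {}Wy : ((y - x) * n.+1%:R : rat) ^+ 2 < 2 := Wy.
  rewrite -real_normK ?num_real // in Wy; move=> h.
  have : 2 * 2 < `|(y - x) * n.+1%:R| ^+ 2 by rewrite expr2 ltr_pM.
  by move=> h'; have := lt_trans h' Wy.
exists (code (0 : rat^o) (@pickle rat) W).
apply: code_finite_bit_coding => //.
- move=> x n; pose f (y : rat^o) : rat^o := ((y - x) * n.+1%:R) ^+ 2.
  have lt_le : f @^-1` [set z | z < 2] = f @^-1` [set z | z <= 2].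
    apply/seteqP; split=> y /=; first exact: ltW.
    by rewrite le_eqVlt (negbTE (sqr_rat_neq2 _)).
  have -> : W x n = f @^-1` [set z | z < 2] by [].
  split; first by apply: open_comp => [y _|]; [exact: W_cts|exact: open_lt].
  by rewrite lt_le; apply: closed_comp => [y _|]; [exact: W_cts|exact: closed_le].
- by move=> x n; rewrite /W /= subrr mul0r expr0n.
- move=> x y xy; exists (ball x `|x - y|).
    by apply: nbhsx_ballx; rewrite normr_gt0 subr_eq0; apply/eqP.
  by rewrite /ball /= ltxx.
- move=> x A /W_base[n nA]; exists (x + n.+1%:R^-1).
    by move=> /eqP; rewrite -subr_eq0 addrAC subrr add0r invr_eq0 pnatr_eq0.
  by apply: nA; rewrite /W /= addrAC subrr add0r mulVf ?pnatr_eq0 // expr1n ltr1n.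
Qed.

(** * The space of primes *)

Section PrimeSpace.
Variable R : realType.

Local Notation primes_space := (set_type primes_set).
Definition prime_val (x : primes_space) : nat := val (set_val x).

Lemma prime_valP x : prime (prime_val x).
Proof. exact: set_valP x. Qed.

Lemma prime_val_inj : injective prime_val.
Proof. by move=> x y /val_inj/val_inj. Qed.

Lemma prime_point p : prime p -> exists x : primes_space, prime_val x = p.
Proof.
move=> pp; have p0 : (0 < p)%N by exact: prime_gt0.
have pin : (Sub p p0 : golomb) \in primes_set by rewrite inE.
by exists (SigSub pin).
Qed.

Lemma open_progression a b : (0 < a)%N -> (0 < b)%N -> coprime a b ->
  open (progression (a, b)).
Proof.
move=> a0 b0 ab; exists [set (a, b)]; last by rewrite bigcup_set1.
by move=> _ ->; split.
Qed.

Lemma open_golombP (A : set golomb) x : open A -> A x ->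
  exists b, [/\ (0 < b)%N, coprime (val x) b & progression (val x, b) `<=` A].
Proof.
move=> [D sD <-] [[a b] Dab [n xab]]; have [/= a0 b0 ab] := sD _ Dab.
exists b; split=> //.
  by rewrite xab /= /coprime mulnC addnC gcdnC gcdnMDl gcdnC.
move=> y [k yk]; exists (a, b) => //; exists (n + k)%N.
by rewrite yk /= xab /= mulnDr addnA.
Qed.

Lemma nbhs_primesP (x : primes_space) (A : set primes_space) : nbhs x A <->
  exists b, [/\ (0 < b)%N, coprime (prime_val x) b &
    forall y n, prime_val y = (prime_val x + b * n)%N -> A y].
Proof.
split.
  rewrite nbhsE => -[_ [[C oC <-] Cx] CA].
  have [b [b0 xb bC]] := open_golombP oC Cx.
  by exists b; split=> // y n yn; apply/CA/bC; exists n.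
move=> [b [b0 xb bA]]; have : nbhs x (set_val @^-1` progression (prime_val x, b)).
  apply: open_nbhs_nbhs; split; last by exists 0%N; rewrite muln0 addn0.
  exists (progression (prime_val x, b)) => //.
  exact: open_progression (prime_gt0 (prime_valP x)) b0 xb.
by apply: filterS => y [n yn]; exact: bA yn.
Qed.

Lemma modn_progression a b y : (a <= y)%N -> y = a %[mod b] ->
  exists n, y = (a + b * n)%N.
Proof.
move=> ay /eqP; rewrite eqn_mod_dvd // => /dvdnP[n yan].
by exists n; rewrite mulnC -yan subnKC.
Qed.

Lemma dirichlet_progression a b : (0 < b)%N -> coprime a b ->
  exists2 p, prime p & exists2 n, (0 < n)%N & p = (a + b * n)%N.
Proof.
move=> b0 ab; have [p [pp ap pab]] : exists p, [/\ prime p, (a < p)%N & p = a %[mod b]].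
  (* [dirichlet_primes] concerns moduli above 1; modulus 1 only asks for a prime larger than [a]. *)
  have [b1|b1] := leqP b 1; last by apply: (dirichlet_primes R) => //; rewrite coprime_sym.
  have [p ap pp] := prime_above a; exists p; split=> //.
  by have -> : b = 1%N; [apply/eqP; rewrite eqn_leq b1|rewrite !modn1].
exists p => //; have [n pE] := modn_progression (ltnW ap) pab.
by exists n => //; rewrite lt0n; apply: contraTneq ap => n0; rewrite pE n0 muln0 addn0 ltnn.
Qed.

Lemma primes_dense : dense primes_set.
Proof.
move=> O [x Ox] oO; have [b [b0 xb bO]] := open_golombP oO Ox.
have [p pp [n _ pE]] := dirichlet_progression b0 xb.
exists (Sub p (prime_gt0 pp)); split; last by [].
by apply: bO; exists n; rewrite SubK.
Qed.

Lemma primes_crowded (x : primes_space) (A : set primes_space) :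
  nbhs x A -> exists2 y, y <> x & A y.
Proof.
move=> /nbhs_primesP[b [b0 xb bA]].
have [p pp [n n0 pE]] := dirichlet_progression b0 xb.
have [y yp] := prime_point pp; exists y; last by apply: (bA y n); rewrite yp.
move=> yx; move: pE; rewrite -yp yx => /eqP.
by rewrite -{1}[prime_val x]addn0 eqn_add2l eq_sym muln_eq0 eqn0Ngt b0 eqn0Ngt n0.
Qed.

Lemma coprime_primes p q : prime p -> prime q -> p != q -> coprime p q.
Proof. by move=> pp pq pq'; rewrite prime_coprime // dvdn_prime2. Qed.

Definition congruence_class M a : set primes_space :=
  [set y | prime_val y = a %[mod M]].

Lemma congruence_open M a : (0 < M)%N -> coprime a M -> open (congruence_class M a).
Proof.
move=> M0 aM; rewrite openE => y /= ya; apply/nbhs_primesP; exists M; split=> //.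
  by rewrite -coprime_modl ya coprime_modl.
by move=> z n zn; rewrite /congruence_class /= zn -ya addnC mulnC modnMDl.
Qed.

(* The closure of [p + b N] picks up only primes dividing the modulus; the
   factors [q < r], with [r = 1 %[mod q]], are chosen to exclude all of them. *)
Lemma congruence_clopen (x : primes_space) b : (0 < b)%N -> coprime (prime_val x) b ->
  exists M, [/\ (prime_val x < M)%N, (b %| M)%N, coprime (prime_val x) M &
    clopen (congruence_class M (prime_val x))].
Proof.
move=> b0 xb; set p := prime_val x; have pp : prime p := prime_valP x.
have [q qmax pq] := prime_above (maxn p b).
move: qmax; rewrite gtn_max => /andP[ltpq ltbq].
have [r [pr ltqr r1]] : exists r, [/\ prime r, (q < r)%N & r = 1 %[mod q]].
  by apply: (dirichlet_primes R); [exact: prime_gt1|exact: coprimen1].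
pose M := (b * (q * r))%N.
have M0 : (0 < M)%N by rewrite !muln_gt0 b0 !prime_gt0.
have qM : (q %| M)%N by rewrite dvdn_mull // dvdn_mulr.
have rM : (r %| M)%N by rewrite dvdn_mull // dvdn_mull.
have cpq : coprime p q by rewrite coprime_primes // neq_ltn ltpq.
have cpr : coprime p r.
  by rewrite coprime_primes // neq_ltn (ltn_trans ltpq ltqr).
have cqr : coprime q r by rewrite coprime_primes // neq_ltn ltqr.
have pM : coprime p M by rewrite !coprimeMr xb cpq cpr.
exists M; split=> //; first by rewrite (leq_trans ltpq) // dvdn_leq.
  exact: dvdn_mulr.
split; first exact: congruence_open.
have modM d y z : (d %| M)%N -> y = z %[mod M] -> y = z %[mod d].
  by move=> dM yz; rewrite -(modn_dvdm y dM) yz modn_dvdm.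
rewrite -[congruence_class _ _]setCK; apply: open_closedC; rewrite openE => y /= yp.
pose s := prime_val y; have ps : prime s := prime_valP y.
have excl d : (0 < d)%N -> (d %| M)%N -> coprime s d -> s <> p %[mod d] ->
    nbhs y (~` congruence_class M p).
  move=> d0 dM sd sp; apply/nbhs_primesP; exists d; split=> // z n zn zp.
  apply: sp; by rewrite -(modM d _ _ dM zp) zn addnC mulnC modnMDl.
(* If [s] is coprime to [M], then [M] itself separates it from [p]. Otherwise [s = q], separated
   modulo [r] as [p < q < r]; or [s = r], separated modulo [q] as [r] is 1 there while [1 < p < q];
   or [s] divides [b], hence differs from [p], and both are below [q]. *)
have [sM|sM] := boolP (coprime s M); first exact: (excl M).
rewrite prime_coprime // negbK !Euclid_dvdM // (dvdn_prime2 ps pq) (dvdn_prime2 ps pr) in sM.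
have [sq|sq] := eqVneq s q.
  apply: (excl r) => //; rewrite ?sq ?prime_gt0 // !modn_small //.
    by move=> qp; rewrite qp ltnn in ltpq.
  exact: ltn_trans ltqr.
have [sr|sr] := eqVneq s r.
  apply: (excl q) => //; rewrite ?prime_gt0 // sr 1?coprime_sym // r1.
  rewrite !modn_small ?prime_gt1 // => p1.
  by rewrite -p1 in pp.
rewrite (negbTE sq) (negbTE sr) !orbF in sM.
have ltsq : (s < q)%N by exact: leq_ltn_trans (dvdn_leq b0 sM) ltbq.
apply: (excl q) => //; rewrite ?prime_gt0 ?coprime_primes // !modn_small //.
by move=> sp; move: xb; rewrite -/p -sp prime_coprime // sM.
Qed.

Lemma primes_finite_bit_coding : exists c, @finite_bit_coding primes_space c.
Proof.
have [x0 _] := @prime_point 2 isT.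
have /choice[M HM] : forall xk : primes_space * nat, exists M,
    (0 < xk.2)%N -> coprime (prime_val xk.1) xk.2 ->
    [/\ (prime_val xk.1 < M)%N, (xk.2 %| M)%N &
      clopen (congruence_class M (prime_val xk.1))].
  move=> [x k]; have [k0|] := posnP k; first by exists 0%N => /=; rewrite k0.
  move=> k0 /=; have [xk|xk] := boolP (coprime (prime_val x) k); last by exists 0%N.
  by have [M [? ? ? ?]] := congruence_clopen k0 xk; exists M.
(* Inadmissible indices receive the whole space, which is clopen, so that the family is total in
   [k]. *)
pose W x k := if (0 < k)%N && coprime (prime_val x) k
  then congruence_class (M (x, k)) (prime_val x) else setT.
exists (code x0 prime_val W).
apply: code_finite_bit_coding.
- exact: prime_val_inj.
- move=> x k; rewrite /W; case: ifPn => [/andP[k0 xk]|_]; last exact: clopenT.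
  by have [] := HM (x, k) k0 xk.
- by move=> x k; rewrite /W; case: ifP.
- move=> x A /nbhs_primesP[b [b0 xb bA]]; exists b; rewrite /W b0 xb /= => y yx.
  have [/= xM bM _] := HM (x, b) b0 xb.
  (* Since [x] lies below the modulus, it is the least element of its residue class, so the class is
     contained in a progression starting at [x]. *)
  have xy : (prime_val x <= prime_val y)%N.
    by rewrite -(modn_small xM) -yx leq_mod.
  have yb : prime_val y = prime_val x %[mod b].
    by rewrite -(modn_dvdm _ bM) yx modn_dvdm.
  by have [n yn] := modn_progression xy yb; exact: bA yn.
- move=> x y xy; have [q qmax pq] := prime_above (maxn (prime_val x) (prime_val y)).
  move: qmax; rewrite gtn_max => /andP[xq yq].
  exists (congruence_class q (prime_val x)).
    apply: open_nbhs_nbhs; split=> //; apply: congruence_open; first exact: prime_gt0.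
    by rewrite coprime_primes ?prime_valP // neq_ltn xq.
  rewrite /congruence_class /= !modn_small // => /prime_val_inj yx.
  exact: xy.
- by move=> x A; exact: primes_crowded.
Qed.
End PrimeSpace.

Lemma homeomorphic_rat_metrizable (R : realType) (T : topologicalType) :
  homeomorphic T rat^o -> metrizable R T.
Proof.
move=> [f [g [fK gK f_cts g_cts]]].
exists (fun x y => ratr `|f x - f y|).
  split.
  - by move=> x y; rewrite ler0q.
  - move=> x y; split=> [/eqP|->]; last by rewrite subrr normr0 rmorph0.
    by rewrite fmorph_eq0 normr_eq0 subr_eq0 => /eqP/(can_inj fK).
  - by move=> x y; rewrite distrC.
  - by move=> x y z; rewrite -rmorphD ler_rat; exact: ler_distD.
move=> A; rewrite openE; split=> [Ao x Ax|Ao x /Ao[e e0 eA]].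
  have : nbhs (f x) (g @^-1` A) by apply: g_cts; rewrite fK; exact: Ao.
  move=> /nbhs_ballP[q /= q0 qA]; exists (ratr q); first by rewrite ltr0q.
  move=> y /=; rewrite ltr_rat => xy; rewrite -(fK y).
  exact: (qA (f y)).
(* Balls of [rat^o] have rational radii, so the real radius is first shrunk to a rational one. *)
have [q] := rat_in_itvoo e0; rewrite in_itv /= ltr0q => /andP[q0 qe].
have fq : nbhs x (f @^-1` ball (f x) q) by apply: f_cts; exact: nbhsx_ballx.
suff : nbhs x A by [].
apply: filterS fq => y /= xy; apply: eA => /=.
by apply: lt_trans qe; rewrite ltr_rat.
Qed.

(* [set_type A] carries the subspace topology of A; [rat^o] carries the
   topology of the absolute value. *)
Theorem theorem3p1 (R : realType) :
  [/\ dense primes_set,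
      metrizable R (set_type primes_set) &
      homeomorphic (set_type primes_set) rat^o].
Proof.
have [c c_coding] := primes_finite_bit_coding R.
have [d d_coding] := rat_finite_bit_coding.
have homeo := homeomorphic_of_codings c_coding d_coding.
split=> //; first exact: primes_dense R.
exact: homeomorphic_rat_metrizable.
Qed.
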